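(* Let $m,n\geqslant1$, $N\geqslant1$ and $(\rho,\sigma)\in\mathcal{P}_{m,n}(N)$. Let $I(\rho,\sigma)$ be the set of integers $a=Nr+c(\rho/\mu)+c(\sigma/\nu)$ for all $r\in\{0,\dots,\min(m,n)\}$ and $(\mu,\nu)\in\Lambda^{(r)}_{m,n}(N)$ with $c^{\mu\nu}_{\rho\sigma}(N)\neq0$, and let $$\mathscr{P}^{(\rho,\sigma)}_{m,n}=\prod_{a\in I(\rho,\sigma)\setminus\{0\}}\Big(1-\tfrac1a\mathscr{A}_{m,n}\Big).$$ Then $I(\rho,\sigma)\subseteq\operatorname{spec}(\mathscr{A}_{m,n})$, and $I(\rho,\sigma)$ is the minimal subset of $\operatorname{spec}(\mathscr{A}_{m,n})$ such that, for every $GL(N)\times GL(N)$-invariant subspace $W\subseteq V^{m,n}$ isomorphic to $U^{(\rho,\varnothing)}\otimes U^{(\varnothing,\sigma)}$, the restriction of $\mathscr{P}^{(\rho,\sigma)}_{m,n}$ to $W$ coincides with the restriction of the traceless projector $\mathscr{P}_{m,n}$ to $W$.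
   Context: $V$ is an $N$-dimensional complex vector space with basis $\{e_i\}$ and dual basis $\{e^i\}$; $V^{m,n}=V^{\otimes m}\otimes V^{*\otimes n}$. $GL(N)\times GL(N)$ acts on $V^{m,n}$ with the first factor acting on the $V$-factors and the second (contragrediently) on the $V^*$-factors. $\mathrm{tr}_{ab'}$ contracts the $a$-th $V$-factor with the $b'$-th $V^*$-factor; $\mathrm{tr}^+_{ab'}$ inserts $\sum_ke_k\otimes e^k$ at these positions; $\tau_{ab'}=\mathrm{tr}^+_{ab'}\circ\mathrm{tr}_{ab'}$ and $\mathscr{A}_{m,n}=\sum_{a,b'}\tau_{ab'}$, with $\operatorname{spec}$ its set of eigenvalues. The traceless projector $\mathscr{P}_{m,n}$ projects onto $\bigcap\ker\mathrm{tr}_{ab'}$ along the span of the images of the $\mathrm{tr}^+_{ab'}$. Partition notation: content $c(\alpha)=\sum_{(i,j)\in\alpha}(j-i)$, $c(\alpha/\beta)=c(\alpha)-c(\beta)$; $\mathcal{P}_{m,n}(N)$ = pairs $(\rho\vdash m,\sigma\vdash n)$ each with at most $N$ parts; $\Lambda^{(r)}_{m,n}(N)$ = pairs $(\mu,\nu)$ with $m-|\mu|=n-|\nu|=r$, $\ell(\mu)+\ell(\nu)\leqslant N$. $U^{(\mu,\nu)}$ is the irreducible rational $GL(N)$-module of highest weight $(\mu_1,\dots,\mu_{\ell(\mu)},0,\dots,0,-\nu_{\ell(\nu)},\dots,-\nu_1)$; $U^{(\rho,\varnothing)}\otimes U^{(\varnothing,\sigma)}$ is the outer tensor product of the polynomial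 irreducible of highest weight $\rho$ and the dual of the polynomial irreducible of highest weight $\sigma$; $c^{\mu\nu}_{\rho\sigma}(N)$ is the multiplicity of $U^{(\mu,\nu)}$ in the restriction of $U^{(\rho,\varnothing)}\otimes U^{(\varnothing,\sigma)}$ to the diagonal $GL(N)$.
   Formalization: Minimality is stated up to the element 0: every subset of spec(A) with the property contains I(ρ,σ)\{0}; literal minimality fails when 0∈I(ρ,σ), as 0 does not enter the product (e.g. m=n=1, N=2, I={0,2}, where {2} already works). *)

(* Defs.v *)
From HB Require Import structures.
From mathcomp Require Import all_boot all_order all_algebra.

Set Implicit Arguments.
Unset Strict Implicit.
Unset Printing Implicit Defensive.

Import Order.TTheory GRing.Theory Num.Theory.
Local Open Scope ring_scope.

Definition is_partition (a : seq nat) : bool :=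
  sorted geq a && all (fun x => 0 < x)%N a.

Definition content (a : seq nat) : int :=
  \sum_(i < size a) \sum_(j < nth 0%N a i) (j%:Z - (i : nat)%:Z).

Notation midx N k := {ffun 'I_k -> 'I_N}.
(* V^{m,n} = V^{(x)m} (x) V*^{(x)n}: T = sum_{a,b} T(a,b) e_a (x) e^b *)
Notation tensor C N m n := {ffun (midx N m * midx N n) -> C^o}.

Section Tensors.
Variable C : numClosedFieldType.
Variable N : nat.

Definition ins k (i : 'I_k) (c : 'I_N) (a : midx N k.-1) : midx N k :=
  [ffun x => if unlift i x is Some y then a y else c].
Definition del k (i : 'I_k) (a : midx N k) : midx N k.-1 :=
  [ffun y => a (lift i y)].

Variables m n : nat.

Definition tr (i : 'I_m) (j : 'I_n) (T : tensor C N m n) : tensor C N m.-1 n.-1 :=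
  [ffun ab : midx N _ * midx N _ => \sum_(k < N) T (ins i k ab.1, ins j k ab.2)].

(* tr^+_{ab'} : V^{m-1,n-1} -> V^{m,n}, inserting sum_k e_k (x) e^k *)
Definition trp (i : 'I_m) (j : 'I_n) (S : tensor C N m.-1 n.-1) : tensor C N m n :=
  [ffun ab : midx N _ * midx N _ => if ab.1 i == ab.2 j then S (del i ab.1, del j ab.2) else 0].

Definition tau (i : 'I_m) (j : 'I_n) (T : tensor C N m n) : tensor C N m n :=
  trp i j (tr i j T).

Definition Aop (T : tensor C N m n) : tensor C N m n :=
  \sum_(i < m) \sum_(j < n) tau i j T.

Definition is_eigenvalue (a : C) : Prop :=
  exists2 v : tensor C N m n, v != 0 & Aop v = a *: v.

Definition traceless (T : tensor C N m n) : Prop := forall i j, tr i j T = 0.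

Definition in_trace_span (T : tensor C N m n) : Prop :=
  exists S : 'I_m -> 'I_n -> tensor C N m.-1 n.-1,
    T = \sum_(i < m) \sum_(j < n) trp i j (S i j).

Definition Pop (s : seq C) : tensor C N m n -> tensor C N m n :=
  foldr (fun a f => if a == 0 then f else (fun T => f T - a^-1 *: Aop (f T)))
        id s.

(* action of (g,h) in GL(N) x GL(N): g on V-factors, h contragrediently
   on V*-factors: g e_k = sum_i g_{ik} e_i,  h e^k = sum_l (h^-1)_{kl} e^l *)
Definition act (g h : 'M[C]_N) (T : tensor C N m n) : tensor C N m n :=
  [ffun ab : midx N _ * midx N _ => \sum_(ab' : midx N m * midx N n)
      ((\prod_(i < m) g (ab.1 i) (ab'.1 i)) *
       (\prod_(j < n) (invmx h) (ab'.2 j) (ab.2 j)) * T ab')].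

Definition is_subspace (W : tensor C N m n -> Prop) : Prop :=
  W 0 /\ forall (a : C) u v, W u -> W v -> W (a *: u + v).

Definition GG_invariant (W : tensor C N m n -> Prop) : Prop :=
  forall g h : 'M[C]_N, g \in unitmx -> h \in unitmx ->
    forall v, W v -> W (act g h v).

Definition D_invariant (W : tensor C N m n -> Prop) : Prop :=
  forall g : 'M[C]_N, g \in unitmx -> forall v, W v -> W (act g g v).

Definition GG_irreducible (W : tensor C N m n -> Prop) : Prop :=
  [/\ is_subspace W, GG_invariant W, (exists2 v, W v & v != 0) &
      forall W', is_subspace W' -> GG_invariant W' ->
        (forall v, W' v -> W v) ->
        (forall v, W' v -> v = 0) \/ (forall v, W v -> W' v)].

Definition D_irreducible (W : tensor C N m n -> Prop) : Prop :=
  [/\ is_subspace W, D_invariant W, (exists2 v, W v & v != 0) &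
      forall W', is_subspace W' -> D_invariant W' ->
        (forall v, W' v -> W v) ->
        (forall v, W' v -> v = 0) \/ (forall v, W v -> W' v)].

(* weight (mu_1,...,mu_l,0,...,0,-nu_l',...,-nu_1) of GL(N) *)
Definition weight (mu nu : seq nat) (i : 'I_N) : int :=
  if (i < size mu)%N then (nth 0%N mu i)%:Z
  else if (N.-1 - i < size nu)%N then - (nth 0%N nu (N.-1 - i))%:Z
  else 0.

Definition torus_char (lam : 'I_N -> int) (t : 'rV[C]_N) : C :=
  \prod_(i < N) (t 0 i) ^ (lam i).

Definition nonzero_row (t : 'rV[C]_N) : Prop := forall i, t 0 i != 0.

Definition unitri (u : 'M[C]_N) : Prop :=
  (forall i j : 'I_N, (j < i)%N -> u i j = 0) /\ (forall i, u i i = 1).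

Definition GG_hwv (W : tensor C N m n -> Prop) (lam1 lam2 : 'I_N -> int)
    (v : tensor C N m n) : Prop :=
  [/\ W v, v != 0,
      (forall t s, nonzero_row t -> nonzero_row s ->
         act (diag_mx t) (diag_mx s) v = (torus_char lam1 t * torus_char lam2 s) *: v) &
      (forall u1 u2, unitri u1 -> unitri u2 -> act u1 u2 v = v)].

Definition D_hwv (W : tensor C N m n -> Prop) (lam : 'I_N -> int)
    (v : tensor C N m n) : Prop :=
  [/\ W v, v != 0,
      (forall t, nonzero_row t ->
         act (diag_mx t) (diag_mx t) v = torus_char lam t *: v) &
      (forall u, unitri u -> act u u v = v)].

(* W is a GL(N)xGL(N)-invariant subspace isomorphic to
   U^(rho,0) (x) U^(0,sigma), the irreducible module of highest weight
   ((rho,0..0), (0..0,-sigma reversed)) *)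
Definition isoU (W : tensor C N m n -> Prop) (rho sigma : seq nat) : Prop :=
  GG_irreducible W /\ exists v, GG_hwv W (weight rho [::]) (weight [::] sigma) v.

(* c^{mu nu}_{rho sigma}(N) <> 0 : U^(mu,nu) occurs in the restriction of
   U^(rho,0) (x) U^(0,sigma) (realised inside V^{m,n}) to the diagonal GL(N) *)
Definition LR_nonzero (rho sigma mu nu : seq nat) : Prop :=
  exists W, isoU W rho sigma /\
    exists W' : tensor C N m n -> Prop,
      [/\ (forall v, W' v -> W v), D_irreducible W' &
          exists v, D_hwv W' (weight mu nu) v].

Definition inI (rho sigma : seq nat) (x : int) : Prop :=
  exists r : nat, (r <= minn m n)%N /\
  exists mu nu : seq nat,
    [/\ is_partition mu, is_partition nu,
        (sumn mu + r = m)%N, (sumn nu + r = n)%N &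
        (size mu + size nu <= N)%N] /\
    LR_nonzero rho sigma mu nu /\
        x = (N * r)%N%:Z + (content rho - content mu)
                         + (content sigma - content nu).

(* restriction of Pop S to every W ~ U^(rho,0)(x)U^(0,sigma) equals the
   traceless projector: Pop S w is traceless and w - Pop S w lies in the
   span of the images of the tr^+ (traceless projection along that span) *)
Definition agrees_with_traceless (S : seq C) (rho sigma : seq nat) : Prop :=
  forall W, isoU W rho sigma ->
    forall w, W w -> traceless (Pop S w) /\ in_trace_span (w - Pop S w).

End Tensors.

(* Main.v *)
Require Import Defs.
From HB Require Import structures.
From Stdlib Require Import Classical.
From mathcomp Require Import all_boot all_order all_algebra.
From mathcomp Require Import fingroup perm zify ring.

Set Implicit Arguments.
Unset Strict Implicit.
Unset Printing Implicit Defensive.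

Import Order.TTheory GRing.Theory Num.Theory.
Local Open Scope ring_scope.

(** The contraction operator is [A = (C_L + C_R - C_D) / 2], where [C_L], [C_R]
    and [C_D] are the Casimir operators of the two [GL(N)] factors and of the
    diagonal [GL(N)].  The first two act by scalars on an irreducible
    [W ~ U^(rho,0) (x) U^(0,sigma)], and [C_D] acts on a highest weight vector of
    weight [(mu, nu)] by a scalar, whence [A = N r + c(rho/mu) + c(sigma/nu)] there.
    Conversely, any eigenspace of [A] in [W] is stable under the diagonal group,
    so it contains an irreducible with a highest weight vector and its eigenvalue
    is in [I(rho, sigma)].  Finally [A] is the sum of the positive self-adjoint
    operators [tau_ab]: it is diagonalisable and its kernel is the space of
    traceless tensors, so the product over [I(rho, sigma) \ {0}] projects [W] onto
    its traceless part, and no nonzero eigenvalue of [A] on [W] can be omitted. *)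

(** * Vandermonde extraction and invariance of the Casimir tensor *)

Section LinearAlgebra.
Variables (C : numClosedFieldType) (V : lmodType C).

(** The representations are given through invertible matrices over an abstract closed field, so no
    differentiation is available. The Lie algebra enters by interpolation instead: the action of
    [1 + t X] is polynomial in [t], and a Vandermonde system writes its linear coefficient as a
    combination of its values at finitely many [t]. Stability of a subspace and identities between
    operators thus pass from the group to the Lie algebra. The same device applied to a torus cuts
    out weight components. The obstacle is that [A] commutes with the diagonal group only, so its
    eigenspaces in [W] need not be submodules for the product group. Complete reducibility,
    characters and the Littlewood-Richardson rule are all avoided: the coefficient enters only as
    the existence of a diagonal irreducible inside [W], found by descent on the dimension. *)

Lemma subspace_sum (W : V -> Prop) (I : finType) (c : I -> C) (F : I -> V) :
  W 0 -> (forall a u v, W u -> W v -> W (a *: u + v)) ->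
  (forall i, W (F i)) -> W (\sum_i c i *: F i).
Proof. by move=> W0 WD WF; elim/big_rec: _ => // i x _ Wx; apply: WD. Qed.

(** The nodes [1, ..., D] are distinct in characteristic zero, so each coefficient is a fixed
    combination of the values. With the zero subspace for [W], vanishing at all nodes becomes
    vanishing of every coefficient. *)
Lemma vandermonde_coef (W : V -> Prop) (D : nat) (w : 'I_D -> V) :
  W 0 -> (forall a u v, W u -> W v -> W (a *: u + v)) ->
  (forall t : 'I_D, W (\sum_(d < D) (t.+1%:R : C) ^+ d *: w d)) ->
  forall d, W (w d).
Proof.
move=> W0 WD Wt e.
pose M := Vandermonde D (\row_(t < D) (t.+1%:R : C)).
have Mu : M \in unitmx.
  rewrite unitmxE unitfE det_Vandermonde; apply/prodf_neq0 => i _.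
  apply/prodf_neq0 => j ij; rewrite !mxE subr_eq0 eqr_nat eqSS.
  by rewrite gtn_eqF.
suff -> : w e = \sum_(t < D) invmx M t e *: \sum_(d < D) (t.+1%:R : C) ^+ d *: w d.
  exact: subspace_sum.
under eq_bigr do rewrite scaler_sumr.
have E (d : 'I_D) : \sum_(t < D) invmx M t e * (t.+1%:R : C) ^+ d = (d == e)%:R.
  have := congr1 (fun A : 'M_D => A d e) (mulmxV Mu).
  rewrite [LHS]mxE [X in _ = X -> _]mxE => <-.
  by apply: eq_bigr => t _; rewrite mulrC; congr (_ * _); rewrite !mxE.
rewrite exchange_big (bigD1 e) //= [X in _ + X]big1 => [|d de].
  under eq_bigr do rewrite scalerA.
  by rewrite addr0 -scaler_suml E eqxx scale1r.
under eq_bigr do rewrite scalerA.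
by rewrite -scaler_suml E (negPf de) scale0r.
Qed.

Lemma linear_mx_delta (N : nat) (f : 'M[C]_N -> V) (X : 'M[C]_N) :
  linear f -> f X = \sum_r \sum_s X r s *: f (delta_mx r s).
Proof.
move=> lf.
have f0 : f 0 = 0.
  by have := lf (-1) 0 0; rewrite scaleN1r addNr => ->; rewrite scaleN1r addNr.
have fsum (I : finType) (c : I -> C) (F : I -> 'M[C]_N) :
    f (\sum_i c i *: F i) = \sum_i c i *: f (F i).
  by elim/big_rec2: _ => // i y z _ <-; rewrite lf.
rewrite {1}[X]matrix_sum_delta pair_bigA /= (fsum _ (fun p : 'I_N * 'I_N => X p.1 p.2)).
by rewrite pair_bigA.
Qed.

(* The tensor [sum_pq E_pq (x) E_qp] is invariant under conjugation. *)
Lemma casimir_conj (N : nat) (B : 'M[C]_N -> 'M[C]_N -> V) (g k : 'M[C]_N) :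
  (forall Y, linear (B^~ Y)) -> (forall X, linear (B X)) -> g *m k = 1%:M ->
  \sum_p \sum_q B (g *m delta_mx p q *m k) (g *m delta_mx q p *m k) =
  \sum_p \sum_q B (delta_mx p q) (delta_mx q p).
Proof.
move=> lB1 lB2 gk.
have gdk p q r s : (g *m delta_mx p q *m k) r s = g r p * k q s.
  rewrite mxE (bigD1 q) //= mxE (bigD1 p) //= mxE !eqxx mulr1 big1 ?addr0.
    rewrite big1 ?addr0 // => i iq.
    by rewrite mxE big1 ?mul0r // => j _; rewrite !mxE (negPf iq) andbF mulr0.
  by move=> i ip; rewrite !mxE (negPf ip) mulr0.
have expand X Y : B X Y = \sum_r \sum_s \sum_r' \sum_s'
    (X r s * Y r' s') *: B (delta_mx r s) (delta_mx r' s').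
  rewrite (linear_mx_delta X (lB1 Y)); apply: eq_bigr => r _; apply: eq_bigr => s _.
  rewrite (linear_mx_delta Y (lB2 _)) scaler_sumr; apply: eq_bigr => r' _.
  by rewrite scaler_sumr; apply: eq_bigr => s' _; rewrite scalerA.
under eq_bigr do under eq_bigr do rewrite expand.
(* The coefficient of [B (delta_mx r s) (delta_mx r' s')] is the product of the entries [(r, s')]
   and [(r', s)] of [g k = 1]. *)
transitivity (\sum_r \sum_s \sum_r' \sum_s' ((r == s')%:R * (r' == s)%:R : C) *:
   B (delta_mx r s) (delta_mx r' s')).
  under eq_bigr do rewrite exchange_big.
  rewrite exchange_big; apply: eq_bigr => r _.
  under eq_bigr do rewrite exchange_big.
  rewrite exchange_big; apply: eq_bigr => s _.
  under eq_bigr do rewrite exchange_big.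
  rewrite exchange_big; apply: eq_bigr => r' _.
  under eq_bigr do rewrite exchange_big.
  rewrite exchange_big; apply: eq_bigr => s' _.
  under eq_bigr do rewrite -scaler_suml.
  rewrite -scaler_suml; congr (_ *: _).
  have gkE i j : (i == j)%:R = \sum_l g i l * k l j.
    by have := congr1 (fun A : 'M_N => A i j) gk; rewrite !mxE => ->.
  rewrite !gkE mulr_suml; apply: eq_bigr => p _; rewrite mulr_sumr.
  by apply: eq_bigr => q _; rewrite !gdk; ring.
apply: eq_bigr => r _; apply: eq_bigr => s _.
rewrite (bigD1 s) //= (bigD1 r) //= !eqxx mulr1 scale1r big1 => [|i ir].
  rewrite addr0 big1 ?addr0 // => i is_; apply: big1 => j _.
  by rewrite (negPf is_) mulr0 scale0r.
by rewrite eq_sym (negPf ir) mul0r scale0r.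
Qed.

End LinearAlgebra.

(** * The group action on mixed tensors and its derivative *)

(** Matrix coefficients of the action of [1 + t X] on a tensor power are such products. The size
    bound limits the number of interpolation nodes; the linear coefficient is the Leibniz rule. *)
Lemma coef_prod_linear (C : comNzRingType) (I : finType) (c d : I -> C) :
  let P := \prod_i ((c i)%:P + d i *: 'X) in
  [/\ (size P <= #|I|.+1)%N, P`_0 = \prod_i c i
    & P`_1 = \sum_i d i * \prod_(j | j != i) c j].
Proof.
pose f i : {poly C} := (c i)%:P + d i *: 'X.
have f0 i : (f i)`_0 = c i by rewrite coefD coefC coefZ coefX mulr0 addr0.
have f1 i : (f i)`_1 = d i by rewrite coefD coefC coefZ coefX mulr1 add0r.
have P0 (r : seq I) (Q : pred I) :
    (\prod_(i <- r | Q i) f i)`_0 = \prod_(i <- r | Q i) c i.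
  by elim/big_rec2: _ => [|i x y _ <-]; [rewrite coef1|rewrite coef0M f0].
move=> P; split.
- rewrite /P cardT enumT; have <- : index_enum I = Finite.enum I by rewrite [LHS]unlock.
  elim: (index_enum I) => [|i r IH].
    by rewrite big_nil size_poly1.
  rewrite big_cons /=; apply: leq_trans (size_polyMleq _ _) _.
  have fi : (size (f i) <= 2)%N.
    apply: leq_trans (size_polyD _ _) _; rewrite geq_max.
    rewrite (leq_trans (size_polyC_leq1 _)) //=.
    by rewrite (leq_trans (size_scale_leq _ _)) ?size_polyX.
  by rewrite -subn1 leq_subLR add1n (leq_add fi IH).
- exact: P0.
rewrite /P -/f; elim: (index_enum I) (index_enum_uniq I) => [|i r IH] /=.
  by rewrite !big_nil coef1.
case/andP=> ir ur.
rewrite !big_cons coefM big_ord_recl big_ord1 /= subn0 f0 f1 P0 IH // eqxx addrC.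
congr (_ + _).
  rewrite [in RHS]big_seq_cond [in LHS]big_seq_cond; congr (_ * _).
  apply: eq_bigl => j; rewrite andbT; case: (boolP (j \in r)) => //= jr.
  by symmetry; apply: contraNneq ir => <-.
rewrite mulr_sumr big_seq [in RHS]big_seq; apply: eq_bigr => k kr.
rewrite big_cons; case: eqVneq => [ik|_] /=; last by rewrite mulrCA.
by rewrite ik kr in ir.
Qed.

Section Operators.
Variables (C : numClosedFieldType) (N : nat).

Definition upd k (a : midx N k) (i : 'I_k) (q : 'I_N) : midx N k :=
  [ffun x => if x == i then q else a x].

Lemma sum_off_one k (a : midx N k) (i : 'I_k) (F : midx N k -> C) :
  \sum_(a' : midx N k) (\prod_(j | j != i) (a j == a' j)%:R) * F a' = \sum_q F (upd a i q).
Proof.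
rewrite (partition_big (fun a' : midx N k => a' i) xpredT) //=.
apply: eq_bigr => q _; rewrite (bigD1 (upd a i q)) /=; last by rewrite ffunE eqxx.
rewrite big1 => [|j ji]; last by rewrite ffunE (negPf ji) eqxx.
rewrite mul1r big1 ?addr0 // => a' /andP[/eqP a'i a'a].
have [j ji aj] : exists2 j, j != i & a j != a' j.
  case: (pickP (fun j => (j != i) && (a j != a' j))) => [j /andP[]|H].
    by exists j.
  case/eqP: a'a; apply/ffunP => j; rewrite ffunE; case: eqVneq => [->|ji] //.
  by have := H j; rewrite ji /= => /negbFE/eqP.
by rewrite (bigD1 j) //= (negPf aj) !mul0r.
Qed.

Lemma prod_delta k (a a' : midx N k) :
  \prod_i (a i == a' i)%:R = (a == a')%:R :> C.
Proof.
case: eqVneq => [->|ne]; first by rewrite big1 // => i _; rewrite eqxx.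
case: (pickP (fun j => a j != a' j)) => [j aj|H].
  by rewrite (bigD1 j) //= (negPf aj) mul0r.
by case/eqP: ne; apply/ffunP => j; apply/eqP/negbFE/H.
Qed.

Section Tensor.
Variables m n : nat.
Local Notation V := (tensor C N m n).

Lemma scale_tensorE (x : C) (T : V) ab : (x *: T) ab = x * T ab.
Proof. by rewrite ffunE. Qed.

Definition act_coef (g h : 'M[C]_N) (ab ab' : midx N m * midx N n) : C :=
  (\prod_i g (ab.1 i) (ab'.1 i)) * (\prod_j h (ab'.2 j) (ab.2 j)).

(* [act] with the inverse of the second matrix as a free argument *)
Definition gact (g h : 'M[C]_N) (T : V) : V :=
  [ffun ab => \sum_ab' act_coef g h ab ab' * T ab'].

Lemma actE g h (T : V) : act g h T = gact g (invmx h) T.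
Proof. by []. Qed.

Lemma act_coef1 ab ab' : act_coef 1%:M 1%:M ab ab' = (ab == ab')%:R.
Proof.
case: ab ab' => a b [a' b']; rewrite /act_coef /= xpair_eqE.
under eq_bigr do rewrite mxE.
under [X in _ * X]eq_bigr do rewrite mxE eq_sym.
by rewrite !prod_delta -natrM mulnb.
Qed.

Lemma gact_is_linear g h : linear (gact g h).
Proof.
move=> x S T; apply/ffunP => ab; rewrite !ffunE /= /GRing.scale /= mulr_sumr -big_split.
by apply: eq_bigr => ab' _; rewrite !ffunE /=; rewrite /GRing.scale /=; ring.
Qed.
HB.instance Definition _ g h := GRing.isLinear.Build C V V _ (gact g h) (gact_is_linear g h).

Lemma gact_comp g h g' h' T :
  gact g h (gact g' h' T) = gact (g *m g') (h' *m h) T.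
Proof.
apply/ffunP => -[a b]; rewrite !ffunE.
under eq_bigr do rewrite ffunE mulr_sumr.
rewrite exchange_big; apply: eq_bigr => -[a'' b''] _ /=.
under eq_bigr do rewrite mulrA.
rewrite -mulr_suml; congr (_ * _); rewrite /act_coef /=.
under [in RHS]eq_bigr do rewrite mxE.
under [X in _ = _ * X]eq_bigr do rewrite mxE.
rewrite !bigA_distr_bigA /= mulr_suml.
under [RHS]eq_bigr do rewrite mulr_sumr.
rewrite pair_bigA /=; apply: eq_bigr => -[a' b'] _ /=.
by rewrite !big_split /=; ring.
Qed.

(** [lieL] and [lieR] are the derivatives of [gact] at the identity in its two arguments. As the
    second argument stands for an inverse, the Lie algebra acts on the dual factors by [- lieR]. *)
Definition lieL (X : 'M[C]_N) (T : V) : V :=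
  [ffun ab : midx N m * midx N n =>
    \sum_i \sum_q X (ab.1 i) q * T (upd ab.1 i q, ab.2)].
Definition lieR (Y : 'M[C]_N) (T : V) : V :=
  [ffun ab : midx N m * midx N n =>
    \sum_j \sum_q Y q (ab.2 j) * T (ab.1, upd ab.2 j q)].

Lemma lieL_is_linear X : linear (lieL X).
Proof.
move=> x S T; apply/ffunP => ab; rewrite !ffunE /= /GRing.scale /= mulr_sumr -big_split.
apply: eq_bigr => i _; rewrite mulr_sumr -big_split.
by apply: eq_bigr => q _; rewrite !ffunE /=; rewrite /GRing.scale /=; ring.
Qed.
HB.instance Definition _ X := GRing.isLinear.Build C V V _ (lieL X) (lieL_is_linear X).
Lemma lieR_is_linear X : linear (lieR X).
Proof.
move=> x S T; apply/ffunP => ab; rewrite !ffunE /= /GRing.scale /= mulr_sumr -big_split.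
apply: eq_bigr => i _; rewrite mulr_sumr -big_split.
by apply: eq_bigr => q _; rewrite !ffunE /=; rewrite /GRing.scale /=; ring.
Qed.
HB.instance Definition _ X := GRing.isLinear.Build C V V _ (lieR X) (lieR_is_linear X).

Lemma lieL_linear_mx T : linear (lieL^~ T).
Proof.
move=> x X Y; apply/ffunP => ab; rewrite !ffunE /= /GRing.scale /= mulr_sumr -big_split.
apply: eq_bigr => i _; rewrite mulr_sumr -big_split.
by apply: eq_bigr => q _; rewrite !mxE /=; ring.
Qed.
Lemma lieR_linear_mx T : linear (lieR^~ T).
Proof.
move=> x X Y; apply/ffunP => ab; rewrite !ffunE /= /GRing.scale /= mulr_sumr -big_split.
apply: eq_bigr => i _; rewrite mulr_sumr -big_split.
by apply: eq_bigr => q _; rewrite !mxE /=; ring.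
Qed.
Lemma lieL0 T : lieL 0 T = 0.
Proof.
by have := lieL_linear_mx T (-1) 0 0; rewrite !scaleN1r !addNr.
Qed.
Lemma lieR0 T : lieR 0 T = 0.
Proof.
by have := lieR_linear_mx T (-1) 0 0; rewrite !scaleN1r !addNr.
Qed.
Lemma lieRN X T : lieR (- X) T = - lieR X T.
Proof.
by have := lieR_linear_mx T (-1) X 0; rewrite !scaleN1r lieR0 !addr0.
Qed.

(** The entries have degree at most [m + n] in [t]. One coefficient more than needed is kept, so
    that the ordinal [1] exists even when [m + n = 0]. *)
Lemma gact_poly (X Y : 'M[C]_N) (T : V) :
  exists w : 'I_(m + n).+2 -> V,
    [/\ w 0 = T, w 1 = lieL X T + lieR Y T &
        forall t, gact (1%:M + t *: X) (1%:M + t *: Y) T = \sum_(d < (m + n).+2) t ^+ d *: w d].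
Proof.
pose PX (a a' : midx N m) := \prod_i ((a i == a' i)%:R%:P + X (a i) (a' i) *: 'X).
pose PY (b b' : midx N n) := \prod_j ((b j == b' j)%:R%:P + Y (b' j) (b j) *: 'X).
pose P (ab ab' : midx N m * midx N n) := PX ab.1 ab'.1 * PY ab.2 ab'.2.
have sP ab ab' : (size (P ab ab') <= (m + n).+1)%N.
  apply: leq_trans (size_polyMleq _ _) _.
  case: (coef_prod_linear (fun i => (ab.1 i == ab'.1 i)%:R : C)
           (fun i => X (ab.1 i) (ab'.1 i))) => + _ _.
  case: (coef_prod_linear (fun j => (ab.2 j == ab'.2 j)%:R : C)
           (fun j => Y (ab'.2 j) (ab.2 j))) => + _ _.
  rewrite -/(PX ab.1 ab'.1) -/(PY ab.2 ab'.2) !card_ord.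
  by move=> h1 h2; rewrite -subn1 leq_subLR add1n -addSn -addnS; exact: leq_add.
pose w (d : 'I_(m + n).+2) : V := [ffun ab => \sum_ab' (P ab ab')`_d * T ab'].
have PX0 a a' : (PX a a')`_0 = (a == a')%:R.
  by case: (coef_prod_linear (fun i => (a i == a' i)%:R : C)
    (fun i => X (a i) (a' i))) => _ -> _; rewrite prod_delta.
have PY0 a a' : (PY a a')`_0 = (a == a')%:R.
  by case: (coef_prod_linear (fun i => (a i == a' i)%:R : C)
    (fun i => Y (a' i) (a i))) => _ -> _; rewrite prod_delta.
exists w; split.
- apply/ffunP => -[a b]; rewrite ffunE (bigD1 (a, b)) //= big1 => [|[a' b'] ne] /=.
    by rewrite addr0 /P /= coef0M PX0 PY0 !eqxx !mul1r.
  rewrite /P coef0M /= PX0 PY0 -natrM mulnb.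
  by rewrite -xpair_eqE eq_sym (negPf ne) mul0r.
- apply/ffunP => -[a b]; rewrite !ffunE /=.
  under eq_bigr => ab' _.
    rewrite /P coefM big_ord_recl big_ord1 /= /bump /= addn0 subn0 PX0 subnn PY0 mulrDl.
    over.
  rewrite big_split [LHS]addrC /=; congr (_ + _).
    transitivity (\sum_a' \sum_b' (PX a a')`_1 * (b == b')%:R * T (a', b')).
      by rewrite pair_bigA; apply: eq_bigr => -[].
    transitivity (\sum_a' (PX a a')`_1 * T (a', b)).
      apply: eq_bigr => a' _; rewrite (bigD1 b) //= eqxx mulr1 big1 ?addr0 //.
      by move=> b' ne; rewrite eq_sym (negPf ne) mulr0 mul0r.
    under [LHS]eq_bigr => a' _.
      case: (coef_prod_linear (fun i => (a i == a' i)%:R : C)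
        (fun i => X (a i) (a' i))) => _ _ /=; rewrite -/(PX a a') => ->.
      rewrite mulr_suml; over.
    rewrite exchange_big; apply: eq_bigr => i _ /=.
    transitivity (\sum_(a' : midx N m) \prod_(j | j != i) (a j == a' j)%:R *
       (X (a i) (a' i) * T (a', b))); first by apply: eq_bigr => a' _; ring.
    rewrite sum_off_one; apply: eq_bigr => q _.
    by rewrite ffunE eqxx.
  transitivity (\sum_a' \sum_b' (a == a')%:R * (PY b b')`_1 * T (a', b')).
    by rewrite pair_bigA; apply: eq_bigr => -[].
  rewrite (bigD1 a) //= [X in _ + X]big1 => [|a' ne]; last first.
    by rewrite big1 // => b' _; rewrite eq_sym (negPf ne) !mul0r.
  rewrite addr0.
  under [LHS]eq_bigr => b' _.
    rewrite eqxx mul1r.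
    case: (coef_prod_linear (fun i => (b i == b' i)%:R : C)
        (fun i => Y (b' i) (b i))) => _ _ /=; rewrite -/(PY b b') => ->.
    rewrite mulr_suml; over.
  rewrite exchange_big; apply: eq_bigr => i _ /=.
  transitivity (\sum_(b' : midx N n) \prod_(j | j != i) (b j == b' j)%:R *
       (Y (b' i) (b i) * T (a, b'))); first by apply: eq_bigr => b' _; ring.
  rewrite sum_off_one; apply: eq_bigr => q _.
  by rewrite ffunE eqxx.
move=> t; apply/ffunP => ab; rewrite ffunE sum_ffunE.
under [RHS]eq_bigr do rewrite scale_tensorE ffunE mulr_sumr.
rewrite exchange_big; apply: eq_bigr => ab' _ /=.
transitivity ((P ab ab').[t] * T ab').
  congr (_ * _); rewrite /P /act_coef hornerM !horner_prod; congr (_ * _).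
    by apply: eq_bigr => i _; rewrite !hornerE !mxE; ring.
  by apply: eq_bigr => i _; rewrite !hornerE !mxE eq_sym; ring.
rewrite (@horner_coef_wide _ (m + n).+2) ?mulr_suml.
  by apply: eq_bigr => d _; ring.
exact: leq_trans (sP _ _) _.
Qed.

End Tensor.
End Operators.

(** * Lie algebra operators and the contraction operator *)

Section LieAction.
Variables (C : numClosedFieldType) (N : nat).

Definition lie1 k (X : 'M[C]_N) (F : midx N k -> C) (a : midx N k) : C :=
  \sum_i \sum_q X (a i) q * F (upd a i q).

Lemma upd_upd k (a : midx N k) i q q' : upd (upd a i q) i q' = upd a i q'.
Proof. by apply/ffunP => x; rewrite !ffunE; case: eqP. Qed.

Lemma upd_updC k (a : midx N k) i j q q' : i != j ->
  upd (upd a i q) j q' = upd (upd a j q') i q.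
Proof.
move=> ij; apply/ffunP => x; rewrite !ffunE; case: (eqVneq x j) => // ->.
by rewrite eq_sym (negPf ij).
Qed.

(* The diagonal terms of the double sum give [lie1 (X *m Y)]; the off-diagonal
   ones are symmetric in [X] and [Y]. *)
Lemma lie1_comm k (X Y : 'M[C]_N) (F : midx N k -> C) a :
  lie1 X (lie1 Y F) a - lie1 Y (lie1 X F) a = lie1 (X *m Y - Y *m X) F a.
Proof.
pose S Z Z' := \sum_(i < k) \sum_(j < k | j != i) \sum_q \sum_q'
   Z (a i) q * Z' (a j) q' * F (upd (upd a i q) j q').
have SC Z Z' : S Z Z' = S Z' Z.
  rewrite /S (exchange_big_dep xpredT) //=; apply: eq_bigr => i _.
  rewrite [LHS](eq_bigl (fun j => j != i)) => [|j]; last by rewrite eq_sym.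
  apply: eq_bigr => j ji; rewrite exchange_big; apply: eq_bigr => q _.
  by apply: eq_bigr => q' _; rewrite upd_updC // [Z _ _ * _]mulrC.
have main Z Z' : lie1 Z (lie1 Z' F) a = lie1 (Z *m Z') F a + S Z Z'.
  rewrite /lie1 /S -big_split /=; apply: eq_bigr => i _.
  under eq_bigr => q _.
    rewrite (bigD1 i) //= mulrDr; over.
  rewrite big_split /=; congr (_ + _).
    under [RHS]eq_bigr do rewrite mxE mulr_suml.
    rewrite [RHS]exchange_big; apply: eq_bigr => q _; rewrite mulr_sumr.
    by apply: eq_bigr => q' _; rewrite ffunE eqxx upd_upd mulrA.
  under eq_bigr do rewrite mulr_sumr.
  rewrite exchange_big; apply: eq_bigr => j ji; apply: eq_bigr => q _.
  rewrite mulr_sumr; apply: eq_bigr => q' _.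
  by rewrite ffunE (negPf ji) mulrA.
rewrite !main (SC Y X) opprD addrACA subrr addr0 /lie1 -sumrB.
apply: eq_bigr => i _; rewrite -sumrB; apply: eq_bigr => q _.
by rewrite [in RHS]mxE [X in _ = (_ + X) * _]mxE; ring.
Qed.

Variables m n : nat.
Local Notation V := (tensor C N m n).
Implicit Types (T : V) (X Y g h : 'M[C]_N).

Lemma sub_tensorE (S T : V) ab : (S - T) ab = S ab - T ab.
Proof. by rewrite !ffunE. Qed.

Lemma lieL1 X T a b : lieL X T (a, b) = lie1 X (fun a => T (a, b)) a.
Proof. by rewrite ffunE. Qed.
Lemma lieR1 X T a b : lieR X T (a, b) = lie1 X^T (fun b => T (a, b)) b.
Proof.
by rewrite ffunE; apply: eq_bigr => j _; apply: eq_bigr => q _; rewrite mxE.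
Qed.

Lemma eq_lie1 k X (F G : midx N k -> C) a : F =1 G -> lie1 X F a = lie1 X G a.
Proof. by move=> E; apply: eq_bigr => i _; apply: eq_bigr => q _; rewrite E. Qed.

Lemma lieL_comm X Y T :
  lieL X (lieL Y T) - lieL Y (lieL X T) = lieL (X *m Y - Y *m X) T.
Proof.
apply/ffunP => -[a b]; rewrite sub_tensorE !lieL1 -lie1_comm.
by congr (_ - _); apply: eq_lie1 => c; rewrite lieL1.
Qed.

Lemma lieR_comm X Y T :
  lieR X (lieR Y T) - lieR Y (lieR X T) = lieR (Y *m X - X *m Y) T.
Proof.
apply/ffunP => -[a b]; rewrite sub_tensorE !lieR1.
have -> : (Y *m X - X *m Y)^T = X^T *m Y^T - Y^T *m X^T.
  by rewrite linearB /= !trmx_mul.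
by rewrite -lie1_comm; congr (_ - _); apply: eq_lie1 => c; rewrite lieR1.
Qed.

Lemma lieLR X Y T : lieL X (lieR Y T) = lieR Y (lieL X T).
Proof.
apply/ffunP => -[a b]; rewrite !ffunE /=.
under eq_bigr do under eq_bigr do rewrite ffunE mulr_sumr /=.
under [RHS]eq_bigr do under eq_bigr do rewrite ffunE mulr_sumr /=.
under eq_bigr do rewrite exchange_big.
rewrite exchange_big; apply: eq_bigr => j _ /=.
under [RHS]eq_bigr do under eq_bigr do rewrite mulr_sumr.
rewrite [RHS]exchange_big; apply: eq_bigr => i _ /=.
under eq_bigr do rewrite mulr_sumr.
rewrite exchange_big; apply: eq_bigr => q _; apply: eq_bigr => p _.
exact: mulrCA.
Qed.

Lemma subspace_lie (W : V -> Prop) X Y T : is_subspace W ->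
  (forall t : nat, W (gact (1%:M + t%:R *: X) (1%:M + t%:R *: Y) T)) ->
  W (lieL X T + lieR Y T).
Proof.
move=> [W0 WD] H; have [w [_ <- E]] := gact_poly X Y T.
by apply: (@vandermonde_coef C _ W _ w) => // t; rewrite -E.
Qed.

Lemma gact_fixed_lie X Y T :
  (forall t : nat, gact (1%:M + t%:R *: X) (1%:M + t%:R *: Y) T = T) ->
  lieL X T + lieR Y T = 0.
Proof.
move=> H; have [w [w0 <- E]] := gact_poly X Y T.
(* Subtracting the constant term [T] leaves a polynomial that vanishes at every node. *)
pose w' d := w d - (d == 0)%:R *: T.
suff: w' 1 = 0 by rewrite /w' /= scale0r subr0.
apply: (@vandermonde_coef C _ (fun v => v = 0) _ w') => // [a u v -> ->|t].
  by rewrite scaler0 addr0.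
under eq_bigr do rewrite /w' scalerBr.
rewrite sumrB -E H (bigD1 0) //= expr0 !scale1r big1 ?addr0 ?subrr // => i i0.
by rewrite (negPf i0) scale0r scaler0.
Qed.

(** Since [k g = 1], [g (1 + t X) = (1 + t g X k) g], and similarly on the dual side. Both sides act
    by polynomials in [t], whose linear coefficients must agree. *)
Lemma gact_lie g k h l X Y T : k *m g = 1%:M -> h *m l = 1%:M ->
  gact g h (lieL X T + lieR Y T) =
  lieL (g *m X *m k) (gact g h T) + lieR (l *m Y *m h) (gact g h T).
Proof.
move=> kg hl; have [w [w0 w1 E]] := gact_poly X Y T.
have [w' [w'0 w'1 E']] := gact_poly (g *m X *m k) (l *m Y *m h) (gact g h T).
rewrite -w1 -w'1; apply/eqP; rewrite -subr_eq0; apply/eqP.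
pose u d := gact g h (w d) - w' d.
apply: (@vandermonde_coef C _ (fun v => v = 0) _ u) => // [a x y -> ->|t].
  by rewrite scaler0 addr0.
under eq_bigr do rewrite scalerBr -linearZ.
rewrite sumrB -raddf_sum -E -E' /= !gact_comp; apply/eqP; rewrite subr_eq0; apply/eqP.
congr (gact _ _ T).
  rewrite mulmxDr mulmxDl mulmx1 mul1mx -scalemxAr -scalemxAl.
  by rewrite -!mulmxA kg mulmx1.
rewrite mulmxDr mulmxDl mulmx1 mul1mx -scalemxAr -scalemxAl.
by rewrite !mulmxA hl mul1mx.
Qed.

Lemma gact_lieL g k h l X T : k *m g = 1%:M -> h *m l = 1%:M ->
  gact g h (lieL X T) = lieL (g *m X *m k) (gact g h T).
Proof.
move=> kg hl; have := gact_lie X 0 T kg hl.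
by rewrite mulmx0 mul0mx !lieR0 !addr0.
Qed.

Lemma gact_lieR g k h l X T : k *m g = 1%:M -> h *m l = 1%:M ->
  gact g h (lieR X T) = lieR (l *m X *m h) (gact g h T).
Proof.
move=> kg hl; have := gact_lie 0 X T kg hl.
by rewrite mulmx0 mul0mx !lieL0 !add0r.
Qed.

(** The dual factors carry the operators [- lieR X], but the two signs cancel in the quadratic
    expression [casR]. *)
Definition casL T : V := \sum_p \sum_q lieL (delta_mx p q) (lieL (delta_mx q p) T).
Definition casR T : V := \sum_p \sum_q lieR (delta_mx p q) (lieR (delta_mx q p) T).

Lemma casL_gact g h T : g \in unitmx -> h \in unitmx ->
  gact g h (casL T) = casL (gact g h T).
Proof.
move=> gu hu; rewrite /casL raddf_sum /=.
under eq_bigr do rewrite raddf_sum /=.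
under eq_bigr do under eq_bigr do rewrite !(gact_lieL _ _ (mulVmx gu) (mulmxV hu)).
apply: (casimir_conj (B := fun X Y => lieL X (lieL Y (gact g h T)))).
- by move=> Y x S S' /=; rewrite lieL_linear_mx.
- by move=> Y x S S' /=; rewrite lieL_linear_mx linearP.
exact: mulmxV.
Qed.

Lemma casR_gact g h T : g \in unitmx -> h \in unitmx ->
  gact g h (casR T) = casR (gact g h T).
Proof.
move=> gu hu; rewrite /casR raddf_sum /=.
under eq_bigr do rewrite raddf_sum /=.
under eq_bigr do under eq_bigr do rewrite !(gact_lieR _ _ (mulVmx gu) (mulmxV hu)).
apply: (casimir_conj (B := fun X Y => lieR X (lieR Y (gact g h T)))).
- by move=> Y x S S' /=; rewrite lieR_linear_mx.
- by move=> Y x S S' /=; rewrite lieR_linear_mx linearP.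
exact: mulVmx.
Qed.

Lemma ins_del k (i : 'I_k) (c : 'I_N) (a : midx N k) : ins i c (del i a) = upd a i c.
Proof.
apply/ffunP => x; rewrite !ffunE; case: unliftP => [y ->|->].
  by rewrite ffunE eq_sym (negPf (neq_lift _ _)).
by rewrite eqxx.
Qed.

Lemma tauE i j T a b : tau i j T (a, b) =
  (a i == b j)%:R * \sum_q T (upd a i q, upd b j q).
Proof.
rewrite ffunE /=; case: eqP => _; last by rewrite mul0r.
by rewrite ffunE mul1r /=; apply: eq_bigr => q _; rewrite !ins_del.
Qed.

(** Both operators look for a slot holding [p] and put [q] there, so the sum over [p] and [q] gives
    [tau] for each pair of slots. This is the cross term of the diagonal Casimir. *)
Lemma AopE T :
  Aop T = \sum_p \sum_q lieL (delta_mx p q) (lieR (delta_mx q p) T).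
Proof.
apply/ffunP => -[a b].
transitivity (\sum_(i < m) \sum_(j < n) (a i == b j)%:R *
   \sum_q T (upd a i q, upd b j q)).
  rewrite /Aop sum_ffunE; apply: eq_bigr => i _; rewrite sum_ffunE.
  by apply: eq_bigr => j _; rewrite tauE.
have lL p q S c d : lieL (delta_mx p q) S (c, d) =
    \sum_i (c i == p)%:R * S (upd c i q, d).
  rewrite ffunE; apply: eq_bigr => i _; rewrite (bigD1 q) //= mxE eqxx andbT.
  rewrite big1 ?addr0 // => q' ne; rewrite mxE (negPf ne) andbF mul0r //.
have lR p q S c d : lieR (delta_mx q p) S (c, d) =
    \sum_j (d j == p)%:R * S (c, upd d j q).
  rewrite ffunE; apply: eq_bigr => i _; rewrite (bigD1 q) //= mxE eqxx /=.
  rewrite big1 ?addr0 // => q' ne; rewrite mxE (negPf ne) mul0r //.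
rewrite sum_ffunE; under [RHS]eq_bigr do rewrite sum_ffunE.
under [RHS]eq_bigr do under eq_bigr do rewrite lL.
under [RHS]eq_bigr do rewrite exchange_big.
rewrite [RHS]exchange_big; apply: eq_bigr => i _ /=.
under [RHS]eq_bigr do under eq_bigr do rewrite lR mulr_sumr.
under [RHS]eq_bigr do rewrite exchange_big.
rewrite [RHS]exchange_big; apply: eq_bigr => j _ /=.
rewrite [RHS](bigD1 (a i)) //= [X in _ = _ + X]big1 => [|p pne].
  rewrite addr0 mulr_sumr; apply: eq_bigr => q _.
  by rewrite eqxx mul1r eq_sym.
by rewrite big1 // => q _; rewrite eq_sym (negPf pne) mul0r.
Qed.

Lemma Aop_is_linear : linear (@Aop C N m n).
Proof.
move=> x S T; rewrite !AopE scaler_sumr -big_split; apply: eq_bigr => p _.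
by rewrite scaler_sumr -big_split; apply: eq_bigr => q _; rewrite !linearP.
Qed.
HB.instance Definition _ := GRing.isLinear.Build C V V _ (@Aop C N m n) Aop_is_linear.

(** The two tensor legs are conjugated by the same matrix because the second argument of [gact] is
    the inverse of the first; this is what restricts the equivariance to the diagonal group. *)
Lemma Aop_gact g T : g \in unitmx -> gact g (invmx g) (Aop T) = Aop (gact g (invmx g) T).
Proof.
move=> gu; rewrite !AopE raddf_sum /=.
under eq_bigr do rewrite raddf_sum /=.
under eq_bigr do under eq_bigr do
  rewrite (gact_lieL _ _ (mulVmx gu) (mulVmx gu)) (gact_lieR _ _ (mulVmx gu) (mulVmx gu)).
apply: (casimir_conj (B := fun X Y => lieL X (lieR Y (gact g (invmx g) T)))).
- by move=> Y x S S' /=; rewrite lieL_linear_mx.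
- by move=> Y x S S' /=; rewrite lieR_linear_mx linearP.
exact: mulmxV.
Qed.

End LieAction.

(** * Casimir eigenvalues of highest weight vectors *)

Section CasimirValue.
Variable N : nat.

(** This is [(lam, lam + 2 delta)] for [gl_N]: with positions counted from 0, [N - 1 - 2 p] is the
    number of positions after [p] minus the number before it. *)
Definition casimir_value (lam : 'I_N -> int) : int :=
  \sum_p (lam p ^+ 2 + lam p * (N%:Z - 1 - 2 * p%:Z)).

Lemma sum_ltn_ord (p : 'I_N) : \sum_(q < N) ((q < p)%N%:R : int) = p%:Z.
Proof.
rewrite -natr_sum -big_mkcond /= -(big_ord_widen N (fun=> 1%N)) ?(ltnW (ltn_ord p)) //.
by rewrite sum1_card card_ord natz.
Qed.

Lemma sum_gtn_ord (p : 'I_N) : \sum_(q < N) ((p < q)%N%:R : int) = N%:Z - 1 - p%:Z.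
Proof.
have -> : N%:Z = \sum_(q < N) 1 by rewrite sumr_const card_ord natz.
rewrite -(sum_ltn_ord p) (bigD1 p) //= [in RHS](bigD1 p) //= [X in _ = _ - X](bigD1 p) //=.
rewrite !ltnn /= mulr0n !add0r [1 + _]addrC addrK -sumrB; apply: eq_bigr => q qp.
by move: qp; rewrite -val_eqE /=; case: ltngtP => //; rewrite ?subr0 ?subrr.
Qed.

(** For [p < q], [E p q] kills [v], so [E p q (E q p v)] is a commutator, of value [lam p - lam q];
    for [p > q] the inner factor already vanishes. The family [E] is abstract because it serves the
    left, the dual and the diagonal action. *)
Lemma casimir_hw (C : numClosedFieldType) (V : lmodType C)
    (E : 'I_N -> 'I_N -> V -> V) (v : V) (lam : 'I_N -> int) :
  (forall p q, E p q 0 = 0) -> (forall p c, E p p (c *: v) = c *: E p p v) ->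
  (forall p q, p != q ->
     E p q (E q p v) - E q p (E p q v) = E p p v - E q q v) ->
  (forall p q : 'I_N, (p < q)%N -> E p q v = 0) ->
  (forall p, E p p v = (lam p)%:~R *: v) ->
  \sum_p \sum_q E p q (E q p v) = (casimir_value lam)%:~R *: v.
Proof.
move=> E0 EZ Ecomm Ehw Ewt.
pose c p q : int := (p == q)%:R * lam p ^+ 2 + (p < q)%N%:R * (lam p - lam q).
have term p q : E p q (E q p v) = (c p q)%:~R *: v.
  rewrite /c; case: (ltngtP p q) => [pq|qp|/val_inj <-].
  - have ne : p != q by rewrite neq_ltn pq.
    have := Ecomm p q ne; rewrite (Ehw _ _ pq) E0 subr0 => ->.
    by rewrite !Ewt -scalerBl -rmorphB (negPf ne) mul0r add0r mul1r.
  - rewrite (Ehw _ _ qp) E0; have /negPf -> : p != q by rewrite neq_ltn qp orbT.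
    by rewrite !mul0r addr0 scale0r.
  by rewrite eqxx mul0r addr0 mul1r Ewt EZ Ewt scalerA -rmorphM expr2.
under eq_bigr do under eq_bigr do rewrite term.
under eq_bigr do rewrite -scaler_suml.
rewrite -scaler_suml; congr (_ *: _).
under eq_bigr do rewrite -rmorph_sum.
rewrite -rmorph_sum; congr (_%:~R).
transitivity (\sum_p \sum_q ((p == q)%:R * lam p ^+ 2 + (p < q)%N%:R * lam p)
   - \sum_(p < N) \sum_(q < N) (p < q)%N%:R * lam q).
  rewrite -sumrB; apply: eq_bigr => p _; rewrite -sumrB; apply: eq_bigr => q _.
  by rewrite /c; ring.
rewrite [X in _ - X]exchange_big -sumrB; apply: eq_bigr => p _.
rewrite big_split /= -!mulr_suml sum_ltn_ord sum_gtn_ord.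
rewrite (bigD1 p) //= eqxx big1 => [|q qp]; first by rewrite /= mulr1n; ring.
by rewrite eq_sym (negPf qp).
Qed.

Lemma sum_weight (mu nu : seq nat) (f : nat -> int -> int) :
  (forall p, f p 0 = 0) -> (size mu + size nu <= N)%N ->
  \sum_(p < N) f p (weight mu nu p) =
  \sum_(i < size mu) f i (nth 0%N mu i)%:Z
  + \sum_(j < size nu) f (N.-1 - j)%N (- (nth 0%N nu j)%:Z).
Proof.
move=> f0 sz.
rewrite (big_ord_widen N (fun i => f i (nth 0%N mu i)%:Z)); last by lia.
rewrite (big_ord_widen N (fun j => f (N.-1 - j)%N (- (nth 0%N nu j)%:Z))); last by lia.
rewrite [X in _ = _ + X](reindex_inj rev_ord_inj) /=.
rewrite big_mkcond [X in _ = _ + X]big_mkcond [X in _ = X + _]big_mkcond -big_split /=.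
apply: eq_bigr => p _; rewrite /weight.
have pN := ltn_ord p.
have -> : (N - p.+1 = N.-1 - p)%N by lia.
have -> : (N.-1 - (N.-1 - p) = p)%N by lia.
case: ltnP => pm; last by case: ifP => _; rewrite ?add0r ?f0.
by case: ifP => pn; [lia|rewrite addr0].
Qed.

Lemma double_content (a : seq nat) :
  2 * content a =
  \sum_(i < size a) ((nth 0%N a i)%:Z ^+ 2 - (nth 0%N a i)%:Z - 2 * i%:Z * (nth 0%N a i)%:Z).
Proof.
rewrite /content mulr_sumr; apply: eq_bigr => i _.
elim: (nth 0%N a i) => [|k IH]; first by rewrite big_ord0; ring.
by rewrite big_ord_recr mulrDr IH /= -natr1; ring.
Qed.

Lemma sumn_nth (a : seq nat) : (sumn a)%:Z = \sum_(i < size a) (nth 0%N a i)%:Z.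
Proof.
rewrite -(big_mkord xpredT (fun i => (nth 0%N a i)%:Z)) -(big_nth 0%N xpredT (fun x => x%:Z)).
by elim: a => [|x a IH]; rewrite ?big_nil ?big_cons //= -IH PoszD.
Qed.

(** A row of length [x] at position [i] contributes [x^2 + x (N - 1 - 2 i)], twice its content plus
    [N x]. A row of [nu] occurs as [- x] at position [N - 1 - i], where the second factor changes
    sign too, so the expression is the same. *)
Lemma casimir_value_weight (mu nu : seq nat) : (size mu + size nu <= N)%N ->
  casimir_value (weight mu nu) =
  2 * content mu + N%:Z * (sumn mu)%:Z + (2 * content nu + N%:Z * (sumn nu)%:Z).
Proof.
move=> sz; rewrite /casimir_value.
rewrite (sum_weight (f := fun p x => x ^+ 2 + x * (N%:Z - 1 - 2 * p%:Z))) //; last first.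
  by move=> p; ring.
rewrite !double_content !sumn_nth !mulr_sumr -!big_split /=.
congr (_ + _); apply: eq_bigr => i _; first by ring.
have -> : (N.-1 - i)%N%:Z = N%:Z - 1 - i%:Z by have := ltn_ord i; lia.
by ring.
Qed.

End CasimirValue.

(** * Weights, root operators and Casimir scalars read off from the group action *)

Section HighestWeight.
Variables (C : numClosedFieldType) (N m n : nat).
Local Notation V := (tensor C N m n).
Implicit Types (v : V) (lam : 'I_N -> int).

Definition cnt k (a : midx N k) (p : 'I_N) : nat := \sum_i (a i == p).

Lemma upd_id k (a : midx N k) i : upd a i (a i) = a.
Proof. by apply/ffunP => x; rewrite ffunE; case: eqP => // ->. Qed.

Lemma lieL_diag p v a b : lieL (delta_mx p p) v (a, b) = (cnt a p)%:R * v (a, b).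
Proof.
rewrite ffunE /= natr_sum mulr_suml; apply: eq_bigr => i _.
rewrite (bigD1 (a i)) //= upd_id !mxE andbb big1 ?addr0 // => q ne.
rewrite mxE; case: eqP => [ap|_]; rewrite /= ?mul0r //.
by rewrite -ap (negPf ne) mul0r.
Qed.

Lemma lieR_diag p v a b : lieR (delta_mx p p) v (a, b) = (cnt b p)%:R * v (a, b).
Proof.
rewrite ffunE /= natr_sum mulr_suml; apply: eq_bigr => i _.
rewrite (bigD1 (b i)) //= upd_id !mxE andbb big1 ?addr0 // => q ne.
rewrite mxE; case: eqP => [qp|_]; rewrite /= ?mul0r //.
by rewrite -qp eq_sym (negPf ne) mul0r.
Qed.

Lemma invmx_diag (t : 'rV[C]_N) : nonzero_row t ->
  diag_mx t \in unitmx /\ invmx (diag_mx t) = diag_mx (\row_i (t 0 i)^-1).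
Proof.
move=> nz.
have E : diag_mx t *m diag_mx (\row_i (t 0 i)^-1) = 1%:M.
  rewrite mulmx_diag; apply/matrixP => i j; rewrite !mxE mulfV //.
have tu := (mulmx1_unit E).1; split=> //.
by rewrite -[LHS]mulmx1 -E mulmxA mulVmx // mul1mx.
Qed.

Lemma gact_diag (t s : 'rV[C]_N) v a b :
  gact (diag_mx t) (diag_mx s) v (a, b) =
  (\prod_i t 0 (a i)) * (\prod_j s 0 (b j)) * v (a, b).
Proof.
rewrite ffunE (bigD1 (a, b)) //= big1 => [|[a' b'] ne].
  rewrite addr0 /act_coef /=; congr (_ * _ * _); apply: eq_bigr => i _;
  by rewrite mxE eqxx.
suff -> : act_coef (diag_mx t) (diag_mx s) (a, b) (a', b') = 0 by rewrite mul0r.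
(* Distinct indices have coefficient 0 for the identity matrices; the slot responsible also kills
   the diagonal coefficient. *)
have := act_coef1 C (a, b) (a', b'); rewrite eq_sym (negPf ne) /act_coef /=.
move/eqP; rewrite mulf_eq0 => /orP[] /prodf_eq0[i _]; rewrite !mxE pnatr_eq0 eqb0 => neq.
  by rewrite (bigD1 i) //= mxE (negPf neq) !mul0r.
by rewrite [X in _ * X](bigD1 i) //= mxE (negPf neq) !(mul0r, mulr0).
Qed.

Lemma act_diag (t s : 'rV[C]_N) v a b : nonzero_row s ->
  act (diag_mx t) (diag_mx s) v (a, b) =
  (\prod_i t 0 (a i)) * (\prod_j (s 0 (b j))^-1) * v (a, b).
Proof.
move=> nz; rewrite actE (invmx_diag nz).2 gact_diag.
by congr (_ * _ * _); apply: eq_bigr => j _; rewrite mxE.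
Qed.

(** Integer powers of 2 with distinct exponents differ in characteristic zero, so this single torus
    element reads off the weight at [p]. *)
Definition two_at (p : 'I_N) : 'rV[C]_N := \row_i (2 ^+ (i == p)).

Lemma two_at_nz p : nonzero_row (two_at p).
Proof. by move=> i; rewrite mxE expf_neq0 // pnatr_eq0. Qed.

Lemma const1_nz : nonzero_row (const_mx 1 : 'rV[C]_N).
Proof. by move=> i; rewrite mxE oner_neq0. Qed.

Lemma torus_char_two p lam : torus_char lam (two_at p) = 2 ^ lam p.
Proof.
rewrite /torus_char (bigD1 p) //= big1 => [|i ip]; rewrite mxE ?eqxx ?mulr1 //.
by rewrite (negPf ip) exp1rz.
Qed.

Lemma torus_char_1 lam : torus_char lam (const_mx 1 : 'rV[C]_N) = 1.
Proof. by rewrite /torus_char big1 // => i _; rewrite mxE exp1rz. Qed.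

Lemma prod_two k p (a : midx N k) : \prod_i two_at p 0 (a i) = 2 ^ (cnt a p)%:Z.
Proof. by under eq_bigr do rewrite mxE; rewrite prodrXr. Qed.

Lemma prod_two_inv k p (a : midx N k) :
  \prod_i (two_at p 0 (a i))^-1 = 2 ^ (- (cnt a p)%:Z).
Proof. by rewrite prodfV prod_two invr_expz. Qed.

Lemma pow2_inj : injective (exprz (2 : C)).
Proof.
have nz : (2 : C) != 0 by rewrite pnatr_eq0.
have main (k : nat) : (2 : C) ^+ k = 1 -> k = 0%N.
  by move/eqP; rewrite -natrX -[1]/(1%:R) eqr_nat -(expn0 2) eqn_exp2l // => /eqP.
move=> x y E; apply/eqP; rewrite -subr_eq0; apply/eqP.
have : (2 : C) ^ (x - y) = 1 by rewrite expfzDr // -invr_expz E mulfV // expfz_neq0.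
case: (x - y) => k; first by move/main ->.
by rewrite NegzE -invr_expz => /(canRL (@invrK _)); rewrite invr1 => /main.
Qed.

Lemma D_torus_diag lam v p :
  (forall t, nonzero_row t -> act (diag_mx t) (diag_mx t) v = torus_char lam t *: v) ->
  lieL (delta_mx p p) v - lieR (delta_mx p p) v = (lam p)%:~R *: v.
Proof.
move=> H; apply/ffunP => -[a b]; rewrite sub_tensorE lieL_diag lieR_diag scale_tensorE.
have := congr1 (fun T : V => T (a, b)) (H _ (two_at_nz p)).
rewrite act_diag ?scale_tensorE; last exact: two_at_nz.
rewrite torus_char_two prod_two prod_two_inv -expfzDr ?pnatr_eq0 //.
have [->|nz] := eqVneq (v (a, b)) 0; first by rewrite !mulr0 subr0.
move/(mulIf nz)/pow2_inj <-.
by rewrite -mulrBl rmorphB.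
Qed.

Lemma GG_torus_diag lam1 lam2 v p :
  (forall t s, nonzero_row t -> nonzero_row s ->
     act (diag_mx t) (diag_mx s) v = (torus_char lam1 t * torus_char lam2 s) *: v) ->
  lieL (delta_mx p p) v = (lam1 p)%:~R *: v /\
  - lieR (delta_mx p p) v = (lam2 p)%:~R *: v.
Proof.
have one_id k (a : midx N k) : \prod_i (const_mx 1 : 'rV[C]_N) 0 (a i) = 1.
  by rewrite big1 // => i _; rewrite mxE.
move=> H; split; apply/ffunP => -[a b]; rewrite ?[(- _ : V) _]ffunE.
  rewrite lieL_diag scale_tensorE.
  have := congr1 (fun T : V => T (a, b)) (H _ _ (two_at_nz p) const1_nz).
  rewrite act_diag ?scale_tensorE; last exact: const1_nz.
  rewrite torus_char_two torus_char_1 mulr1 prod_two prodfV one_id invr1 mulr1.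
  have [->|nz] := eqVneq (v (a, b)) 0; first by rewrite !mulr0.
  by move/(mulIf nz)/pow2_inj <-.
rewrite lieR_diag scale_tensorE.
have := congr1 (fun T : V => T (a, b)) (H _ _ const1_nz (two_at_nz p)).
rewrite act_diag ?scale_tensorE; last exact: two_at_nz.
rewrite torus_char_two torus_char_1 mul1r prod_two_inv one_id mul1r.
have [->|nz] := eqVneq (v (a, b)) 0; first by rewrite !mulr0 oppr0.
by move/(mulIf nz)/pow2_inj <-; rewrite rmorphN mulNr.
Qed.

(** A natural [t] keeps the matrix invertible even for [p = q], where the diagonal entry is [1 + t];
    hence natural interpolation nodes. *)
Lemma elementary_unit (p q : 'I_N) (t : nat) :
  1%:M + t%:R *: delta_mx p q \in (unitmx : pred 'M[C]_N).
Proof.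
have [<-|ne] := eqVneq p q.
  have nz : nonzero_row (\row_i (1 + t%:R * (i == p)%:R) : 'rV[C]_N).
    by move=> i; rewrite mxE -natrM -[1]/(1%:R) -natrD pnatr_eq0.
  rewrite (_ : _ + _ = diag_mx (\row_i (1 + t%:R * (i == p)%:R))).
    exact: (invmx_diag nz).1.
  apply/matrixP => i j; rewrite !mxE.
  case: (eqVneq i j) => [<-|ij]; first by rewrite andbb mulr1n.
  by case: eqVneq => [<-|_] /=; rewrite ?mulr0 ?addr0 // eq_sym (negPf ij) mulr0 addr0.
suff E : (1%:M + t%:R *: delta_mx p q) *m (1%:M - t%:R *: delta_mx p q) = 1%:M :> 'M[C]_N.
  exact: (mulmx1_unit E).1.
rewrite mulmxBr mulmx1 mulmxDl mul1mx -scalemxAl -scalemxAr mul_delta_mx_0 //.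
  by rewrite !scaler0 addr0 addrK.
by rewrite eq_sym.
Qed.

Lemma elementary_inv (p q : 'I_N) (t : nat) : p != q ->
  invmx (1%:M + t%:R *: delta_mx p q : 'M[C]_N) = 1%:M + t%:R *: - delta_mx p q.
Proof.
move=> ne.
have E : (1%:M + t%:R *: delta_mx p q) *m (1%:M + t%:R *: - delta_mx p q) = 1%:M :> 'M[C]_N.
  rewrite scalerN mulmxBr mulmx1 mulmxDl mul1mx -scalemxAl -scalemxAr mul_delta_mx_0 //.
    by rewrite !scaler0 addr0 addrK.
  by rewrite eq_sym.
by rewrite -[LHS]mulmx1 -[X in _ *m X]E mulmxA mulVmx ?mul1mx // elementary_unit.
Qed.

Lemma elementary_unitri (p q : 'I_N) (t : nat) : (p < q)%N ->
  unitri (1%:M + t%:R *: delta_mx p q : 'M[C]_N).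
Proof.
move=> pq; split=> [i j ji|i]; rewrite !mxE.
  have /negPf -> : i != j by rewrite neq_ltn ji orbT.
  case: eqVneq => [ip|_] /=; last by rewrite mulr0 addr0.
  case: eqVneq => [jq|_] /=; last by rewrite mulr0 addr0.
  by move: ji; rewrite ip jq; lia.
rewrite eqxx; case: eqVneq => [->|_] /=; last by rewrite mulr0 addr0.
by have /negPf -> : p != q; rewrite ?neq_ltn ?pq // mulr0 addr0.
Qed.

Lemma unitri1 : unitri (1%:M : 'M[C]_N).
Proof.
split=> [i j ji|i]; rewrite mxE ?eqxx //.
by have /negPf -> : i != j by rewrite neq_ltn ji orbT.
Qed.

Lemma D_unitri_lie v (p q : 'I_N) : (forall u, unitri u -> act u u v = v) -> (p < q)%N ->
  lieL (delta_mx p q) v - lieR (delta_mx p q) v = 0.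
Proof.
move=> H pq; rewrite -lieRN; apply: gact_fixed_lie => t.
have ne : p != q by rewrite neq_ltn pq.
by rewrite -elementary_inv // -actE H //; exact: elementary_unitri.
Qed.

Lemma GG_unitri_lie v (p q : 'I_N) :
  (forall u1 u2, unitri u1 -> unitri u2 -> act u1 u2 v = v) -> (p < q)%N ->
  lieL (delta_mx p q) v = 0 /\ - lieR (delta_mx p q) v = 0.
Proof.
move=> H pq; have ne : p != q by rewrite neq_ltn pq.
split.
  rewrite -[LHS]addr0 -[X in _ + X](lieR0 v); apply: gact_fixed_lie => t.
  rewrite scaler0 addr0 -[X in gact _ X]invmx1 -actE H //.
    exact: elementary_unitri.
  exact: unitri1.
rewrite -lieRN -[LHS]add0r -[X in X + _](lieL0 v); apply: gact_fixed_lie => t.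
rewrite scaler0 addr0 -elementary_inv // -actE H //; first exact: unitri1.
exact: elementary_unitri.
Qed.

Lemma delta_comm (p q : 'I_N) :
  delta_mx p q *m delta_mx q p - delta_mx q p *m delta_mx p q =
  delta_mx p p - delta_mx q q :> 'M[C]_N.
Proof. by rewrite !mul_delta_mx. Qed.

Lemma lieLB X Y v : lieL (X - Y) v = lieL X v - lieL Y v.
Proof. by rewrite addrC -scaleN1r lieL_linear_mx scaleN1r addrC. Qed.
Lemma lieRB X Y v : lieR (X - Y) v = lieR X v - lieR Y v.
Proof. by rewrite addrC -scaleN1r lieR_linear_mx scaleN1r addrC. Qed.

Lemma lieRNr X v : lieR X (- v) = - lieR X v.
Proof. exact: raddfN. Qed.
Lemma lieLBr X v w : lieL X (v - w) = lieL X v - lieL X w.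
Proof. exact: raddfB. Qed.
Lemma lieRBr X v w : lieR X (v - w) = lieR X v - lieR X w.
Proof. exact: raddfB. Qed.

Lemma lieLZr X c v : lieL X (c *: v) = c *: lieL X v.
Proof. exact: linearZ. Qed.
Lemma lieRZr X c v : lieR X (c *: v) = c *: lieR X v.
Proof. exact: linearZ. Qed.

Lemma casL_hwv W lam1 lam2 v : GG_hwv W lam1 lam2 v ->
  casL v = (casimir_value lam1)%:~R *: v.
Proof.
case=> _ _ ht hu; apply: (casimir_hw (E := fun p q => lieL (delta_mx p q))).
- by move=> p q; rewrite linear0.
- by move=> p c; rewrite linearZ.
- by move=> p q pq; rewrite lieL_comm delta_comm lieLB.
- by move=> p q pq; exact: (GG_unitri_lie hu pq).1.
by move=> p; exact: (GG_torus_diag p ht).1.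
Qed.

Lemma casR_hwv W lam1 lam2 v : GG_hwv W lam1 lam2 v ->
  casR v = (casimir_value lam2)%:~R *: v.
Proof.
case=> _ _ ht hu.
transitivity (\sum_p \sum_q - lieR (delta_mx p q) (- lieR (delta_mx q p) v)).
  by apply: eq_bigr => p _; apply: eq_bigr => q _; rewrite lieRNr opprK.
apply: (casimir_hw (E := fun p q x => - lieR (delta_mx p q) x)).
- by move=> p q; rewrite linear0 oppr0.
- by move=> p c; rewrite linearZ scalerN.
- move=> p q pq; rewrite !lieRNr !opprK lieR_comm.
  by rewrite -opprB delta_comm lieRN lieRB opprB addrC.
- by move=> p q pq; exact: (GG_unitri_lie hu pq).2.
by move=> p; exact: (GG_torus_diag p ht).2.
Qed.

Lemma D_hwv_casimir W lam v : D_hwv W lam v ->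
  casL v + casR v - 2 *: Aop v = (casimir_value lam)%:~R *: v.
Proof.
case=> _ _ ht hu.
rewrite -(casimir_hw (E := fun p q x => lieL (delta_mx p q) x - lieR (delta_mx p q) x)
  (v := v)).
- have -> : \sum_p \sum_q (lieL (delta_mx p q) (lieL (delta_mx q p) v - lieR (delta_mx q p) v)
     - lieR (delta_mx p q) (lieL (delta_mx q p) v - lieR (delta_mx q p) v)) =
    casL v + casR v - (Aop v + \sum_q \sum_p lieL (delta_mx q p) (lieR (delta_mx p q) v)).
    rewrite [X in _ = _ - (_ + X)]exchange_big AopE /casL /casR -!big_split -sumrB.
    apply: eq_bigr => p _; rewrite -!big_split -sumrB; apply: eq_bigr => q _.
    rewrite lieLBr lieRBr -[lieR _ (lieL _ v)]lieLR opprB.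
    by rewrite opprD addrACA.
  by rewrite -AopE scaler_nat mulr2n.
- by move=> p q; rewrite (raddf0 (lieL _)) (raddf0 (lieR _)) subr0.
- by move=> p c; rewrite lieLZr lieRZr scalerBr.
- move=> p q pq; rewrite !lieLBr !lieRBr.
  rewrite -![lieR _ (lieL _ v)]lieLR.
  have EL := lieL_comm (delta_mx p q) (delta_mx q p) v.
  have ER := lieR_comm (delta_mx q p) (delta_mx p q) v.
  rewrite delta_comm lieLB in EL; rewrite delta_comm lieRB in ER.
  have abel (a b x y : V) : a - x - (y - b) = a + b - (x + y).
    by rewrite opprB opprD addrACA.
  (* Left and dual operators commute, so the mixed terms cancel and the commutator of the
     differences reduces to the two separate commutators. *)
  have abel2 (a a' b b' x y c c' d d' : V) : a - a' = c - c' -> b' - b = d - d' ->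
      a - x - (y - b) - (a' - y - (x - b')) = c - d - (c' - d').
    move=> E1 E2; rewrite (abel a) (abel a') [y + x]addrC opprB addrA subrK opprD addrACA E1.
    by rewrite -[b - b']opprB E2 !opprB addrACA [RHS]addrACA [- d - _]addrC.
  exact: abel2.
- by move=> p q pq; exact: D_unitri_lie.
by move=> p; exact: D_torus_diag.
Qed.

Lemma casL_is_linear : linear (@casL C N m n).
Proof.
move=> x S T; rewrite /casL scaler_sumr -big_split; apply: eq_bigr => p _.
by rewrite scaler_sumr -big_split; apply: eq_bigr => q _; rewrite !linearP.
Qed.
Lemma casR_is_linear : linear (@casR C N m n).
Proof.
move=> x S T; rewrite /casR scaler_sumr -big_split; apply: eq_bigr => p _.
by rewrite scaler_sumr -big_split; apply: eq_bigr => q _; rewrite !linearP.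
Qed.

(** A form of Schur's lemma: the vectors of [W] on which [f] is [c] form a submodule containing [v],
    hence all of [W]. The eigenvalue [c] is supplied by the highest weight vector. *)
Lemma irreducible_scalar (W : V -> Prop) (f : V -> V) (c : C) v :
  GG_irreducible W -> linear f ->
  (forall g h w, g \in unitmx -> h \in unitmx -> gact g h (f w) = f (gact g h w)) ->
  W v -> v != 0 -> f v = c *: v -> forall w, W w -> f w = c *: w.
Proof.
case=> [[W0 WD] Winv _ Wirr] lf fact Wv v0 fv.
have f0 : f 0 = 0.
  by have := lf (-1) 0 0; rewrite scaleN1r addNr => ->; rewrite scaleN1r addNr.
case: (Wirr (fun w => W w /\ f w = c *: w)).
- split=> [|a x y [Wx fx] [Wy fy]]; first by rewrite f0 scaler0.
  split; first exact: WD.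
  by rewrite lf fx fy scalerDr !scalerA mulrC.
- move=> g h gu hu w [Ww fw]; split; first exact: Winv.
  by rewrite actE -fact ?unitmx_inv // fw linearZ.
- by move=> w [].
- by move=> H; case/eqP: v0; apply: H.
by move=> H w /H[].
Qed.

Lemma Aop_hwv (rho sigma mu nu : seq nat) (r : nat) (W W' : V -> Prop) v :
  sumn rho = m -> (size rho <= N)%N -> sumn sigma = n -> (size sigma <= N)%N ->
  (sumn mu + r = m)%N -> (sumn nu + r = n)%N -> (size mu + size nu <= N)%N ->
  isoU W rho sigma -> (forall w, W' w -> W w) -> D_hwv W' (weight mu nu) v ->
  Aop v = ((N * r)%N%:Z + (content rho - content mu)
                         + (content sigma - content nu))%:~R *: v.
Proof.
move=> srho lrho ssig lsig smu snu lmn [Wirr [u hu]] sW hv.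
have [Wu u0 _ _] := hu; have [W'v v0 _ _] := hv.
have cL := irreducible_scalar Wirr casL_is_linear
  (fun g h w gu hu => casL_gact w gu hu) Wu u0 (casL_hwv hu) (sW _ W'v).
have cR := irreducible_scalar Wirr casR_is_linear
  (fun g h w gu hu => casR_gact w gu hu) Wu u0 (casR_hwv hu) (sW _ W'v).
have := D_hwv_casimir hv; rewrite cL cR.
rewrite !casimir_value_weight ?addn0 //= => E.
have nz2 : (2 : C) != 0 by rewrite pnatr_eq0.
apply: (scalerI nz2); move/eqP: E.
rewrite subr_eq [X in _ == X]addrC -subr_eq => /eqP <-; rewrite -!scaleNr -!scalerDl scalerA; congr (_ *: _).
rewrite -mulrNz -!intrD -[X in _ = X * _]/(2%:~R) -intrM; congr (_%:~R).
have -> : content [::] = 0 by rewrite /content big_ord0.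
rewrite -srho -ssig in smu snu *.
(* The Casimir values contribute [N (m - |mu|)] and [N (n - |nu|)], both equal to [N r]; halving
   their sum leaves one [N r]. *)
have -> : (sumn rho)%:Z = (sumn mu)%:Z + r%:Z by rewrite -PoszD smu.
have -> : (sumn sigma)%:Z = (sumn nu)%:Z + r%:Z by rewrite -PoszD snu.
by rewrite PoszM; ring.
Qed.

End HighestWeight.

(** * Positivity of the contraction operator *)

Section Positivity.
Variables (C : numClosedFieldType) (N m n : nat).
Local Notation V := (tensor C N m n).
Implicit Types S T : V.

Definition dot S T : C := \sum_ab S ab * (T ab)^*.

Lemma dotDl (x : C) S S' T : dot (x *: S + S') T = x * dot S T + dot S' T.
Proof.
rewrite /dot mulr_sumr -big_split; apply: eq_bigr => ab _.
by rewrite ffunE scale_tensorE mulrDl mulrA.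
Qed.

Lemma dotDr (x : C) S T T' : dot S (x *: T + T') = x^* * dot S T + dot S T'.
Proof.
rewrite /dot mulr_sumr -big_split; apply: eq_bigr => ab _.
by rewrite ffunE scale_tensorE rmorphD rmorphM mulrDr mulrCA.
Qed.

Lemma dotBl (x : C) S S' T : dot (S' - x *: S) T = dot S' T - x * dot S T.
Proof. by rewrite addrC -scaleNr dotDl mulNr addrC. Qed.
Lemma dotBr (x : C) S T T' : dot S (T' - x *: T) = dot S T' - x^* * dot S T.
Proof. by rewrite addrC -scaleNr dotDr rmorphN mulNr addrC. Qed.

Lemma dot0l T : dot 0 T = 0.
Proof. by rewrite /dot big1 // => ab _; rewrite ffunE mul0r. Qed.
Lemma dot0r T : dot T 0 = 0.
Proof. by rewrite /dot big1 // => ab _; rewrite ffunE rmorph0 mulr0. Qed.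

Lemma dot_suml (I : finType) (F : I -> V) T : dot (\sum_i F i) T = \sum_i dot (F i) T.
Proof.
elim/big_rec2: _ => [|i x y _ <-]; first by rewrite dot0l.
by rewrite -[F i]scale1r dotDl mul1r scale1r.
Qed.
Lemma dot_sumr (I : finType) (F : I -> V) T : dot T (\sum_i F i) = \sum_i dot T (F i).
Proof.
elim/big_rec2: _ => [|i x y _ <-]; first by rewrite dot0r.
by rewrite -[F i]scale1r dotDr rmorph1 mul1r scale1r.
Qed.

Lemma dot_ge0 T : 0 <= dot T T.
Proof. by apply: sumr_ge0 => ab _; rewrite -normCK exprn_ge0. Qed.

Lemma dot_eq0 T : dot T T = 0 -> T = 0.
Proof.
move=> /eqP; rewrite psumr_eq0 => [/allP H|ab _]; last by rewrite -normCK exprn_ge0.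
apply/ffunP => ab; rewrite ffunE; apply/eqP.
by have := H ab (mem_index_enum _); rewrite /= -normCK expf_eq0 normr_eq0.
Qed.

(** A basis index with equal entries in slots [i] and [j], together with a new value [q], lists a
    nonzero entry of the 0/1 matrix of [tau]. The involution [phi] swaps old and new values, that
    is, transposes the matrix. *)
Lemma tau_adj i j S T : dot (tau i j S) T = dot S (tau i j T).
Proof.
pose P (x : (midx N m * midx N n) * 'I_N) := x.1.1 i == x.1.2 j.
pose phi (x : (midx N m * midx N n) * 'I_N) := ((upd x.1.1 i x.2, upd x.1.2 j x.2), x.1.1 i).
pose F S T (x : (midx N m * midx N n) * 'I_N) :=
  S (upd x.1.1 i x.2, upd x.1.2 j x.2) * (T x.1)^*.
have phiK x : P x -> phi (phi x) = x.
  case: x => [[a b] q]; rewrite /P /phi /= => /eqP ab.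
  by rewrite !upd_upd {2}ab !upd_id !ffunE eqxx.
transitivity (\sum_(x | P x) F S T x).
  rewrite big_mkcond /= -(pair_bigA _ (fun ab q => if P (ab, q) then F S T (ab, q) else 0)).
  apply: eq_bigr => -[a b] _; rewrite tauE /P /=; case: eqP => _.
    by rewrite mul1r mulr_suml.
  by rewrite !mul0r big1.
rewrite (reindex_onto phi phi) //=.
transitivity (\sum_(x | P x) S x.1 * (T (phi x).1)^*).
  apply: eq_big => x.
    case: x => [[a b] q]; rewrite /P /phi /= !ffunE !eqxx /=.
    apply/eqP/eqP => E; last by rewrite !upd_upd {2}E !upd_id.
    have := congr1 (fun x : (midx N m * midx N n) * 'I_N => x.1.2 j) E.
    by rewrite /= upd_upd ffunE eqxx.
  move/andP => [_ /eqP E]; rewrite /F; congr (S _ * _).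
  by have := congr1 fst E.
rewrite big_mkcond /= -(pair_bigA _ (fun ab q => if P (ab, q) then S ab * (T (phi (ab, q)).1)^* else 0)).
apply: eq_bigr => -[a b] _; rewrite tauE /P /=; case: eqP => _.
  by rewrite mul1r rmorph_sum mulr_sumr.
by rewrite !mul0r rmorph0 mulr0 big1.
Qed.

(** With [tau_adj], this yields [N <tau T, T> = |tau T|^2], the positivity of each summand of
    [A]. *)
Lemma tau_tau i j T : tau i j (tau i j T) = N%:R *: tau i j T.
Proof.
apply/ffunP => -[a b]; rewrite scale_tensorE !tauE mulrCA; congr (_ * _).
under eq_bigr => q _.
  rewrite tauE !ffunE !eqxx mul1r.
  under eq_bigr do rewrite !upd_upd.
  over.
by rewrite sumr_const card_ord mulr_natl.
Qed.

Lemma Aop_adj S T : dot (Aop S) T = dot S (Aop T).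
Proof.
rewrite /Aop dot_suml dot_sumr; apply: eq_bigr => i _.
by rewrite dot_suml dot_sumr; apply: eq_bigr => j _; rewrite tau_adj.
Qed.

Lemma Aop_semisimple (a : C) T : a^* = a ->
  Aop (Aop T - a *: T) - a *: (Aop T - a *: T) = 0 -> Aop T - a *: T = 0.
Proof.
move=> areal H; apply: dot_eq0; set U := Aop T - _ in H *.
have <- : dot (Aop U - a *: U) T = dot U U.
  by rewrite dotBl Aop_adj -[X in _ = dot _ X]/(Aop T - a *: T) dotBr areal.
by rewrite H dot0l.
Qed.

Lemma del_ins k (i : 'I_k) (c : 'I_N) (a : midx N k.-1) : del i (ins i c a) = a.
Proof. by apply/ffunP => x; rewrite !ffunE liftK. Qed.

Lemma Aop_eq0_traceless T : (0 < N)%N -> Aop T = 0 -> traceless T.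
Proof.
move=> N0 A0 i j.
have NC : (N%:R : C) != 0 by rewrite pnatr_eq0 -lt0n.
have tau_dot i' j' : N%:R * dot (tau i' j' T) T = dot (tau i' j' T) (tau i' j' T).
  by rewrite -tau_adj tau_tau -[_ *: _]addr0 dotDl dot0l addr0.
have tau0 : dot (tau i j T) (tau i j T) = 0.
  have /eqP : \sum_i' \sum_j' dot (tau i' j' T) (tau i' j' T) = 0.
    transitivity (N%:R * dot (Aop T) T); last by rewrite A0 dot0l mulr0.
    rewrite /Aop dot_suml mulr_sumr; apply: eq_bigr => i' _.
    by rewrite dot_suml mulr_sumr; apply: eq_bigr => j' _.
  rewrite psumr_eq0 => [/allP/(_ i (mem_index_enum _))|i' _]; last first.
    by apply: sumr_ge0 => j' _; exact: dot_ge0.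
  rewrite /= psumr_eq0 => [/allP/(_ j (mem_index_enum _))/eqP //|j' _].
  exact: dot_ge0.
(* Injectivity of [tr^+]: the trace at [(a, b)] is an entry of [tau i j T] at which both inserted
   slots hold the same value, here 0. *)
apply/ffunP => -[a b]; rewrite !ffunE /=.
have := congr1 (fun S : V => S (ins i (Ordinal N0) a, ins j (Ordinal N0) b)) (dot_eq0 tau0).
rewrite [in RHS]ffunE tauE => E; rewrite -[RHS]E.
have insi k (l : 'I_k) (c : midx N k.-1) : ins l (Ordinal N0) c l = Ordinal N0.
  by rewrite ffunE unlift_none.
rewrite !insi eqxx mul1r.
apply: eq_bigr => q _.
by rewrite -!ins_del !del_ins.
Qed.

End Positivity.

(** * Existence of highest weight vectors *)

Lemma bounded_max (P : nat -> Prop) (d B : nat) :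
  P d -> (forall k, P k -> (k <= B)%N) ->
  exists2 k, P k & forall l, P l -> (l <= k)%N.
Proof.
move=> Pd PB.
have [e] := ubnP (B - d); elim: e d Pd => // e IH d Pd Bd.
have [[l [Pl dl]]|no] := classic (exists l, P l /\ (d < l)%N).
  by apply: (IH l) => //; have := PB l Pl; lia.
by exists d => // l Pl; case: leqP => // dl; case: no; exists l.
Qed.

Lemma digits_inj (B N : nat) (d d' : 'I_N -> nat) :
  (forall p, d p < B)%N -> (forall p, d' p < B)%N ->
  (\sum_p d p * B ^ (N.-1 - p) = \sum_p d' p * B ^ (N.-1 - p))%N -> d =1 d'.
Proof.
elim: N d d' => [|N IH] d d' dB dB' E; first by case.
have step (f : 'I_N.+1 -> nat) : (\sum_p f p * B ^ (N.+1.-1 - p) =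
    (\sum_(p < N) f (widen_ord (leqnSn N) p) * B ^ (N.-1 - p)) * B + f ord_max)%N.
  rewrite big_ord_recr /= subnn expn0 muln1; congr addn.
  rewrite big_distrl /=; apply: eq_bigr => p _.
  by rewrite -mulnA -expnSr; congr (_ * _ ^ _)%N; have := ltn_ord p; lia.
rewrite !step in E.
have Emax : d ord_max = d' ord_max.
  by have := congr1 (modn^~ B) E; rewrite !modnMDl !modn_small.
have B0 : (0 < B)%N := leq_ltn_trans (leq0n _) (dB ord_max).
have Ew : (fun p => d (widen_ord (leqnSn N) p)) =1 (fun p => d' (widen_ord (leqnSn N) p)).
  apply: IH => [p|p|]; [exact: dB|exact: dB'|].
  by have := congr1 (divn^~ B) E; rewrite !divnMDl // !divn_small // !addn0.
move=> p; have [j ->|->] := unliftP ord_max p => //.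
have -> : lift ord_max j = widen_ord (leqnSn N) j by apply: val_inj; exact: lift_max.
exact: Ew.
Qed.

Lemma downset_threshold (Q : pred nat) (N : nat) :
  (forall i j, (i <= j)%N -> (j < N)%N -> Q j -> Q i) ->
  exists2 k, (k <= N)%N & forall p, (p < N)%N -> Q p = (p < k)%N.
Proof.
elim: N => [|N IH] H; first by exists 0%N.
have [i j ij jN|k kN Hk] := IH; first by apply: H => //; exact: ltnW.
have [QN|QN] := boolP (Q N).
  by exists N.+1 => // p pN; rewrite pN; exact: (H p N).
exists k; first exact: leqW.
move=> p; rewrite ltnS leq_eqVlt => /orP[/eqP ->|/Hk //].
by rewrite (negPf QN) ltnNge kN.
Qed.

Lemma dominant_weight (N : nat) (lam : 'I_N -> int) :
  (forall p q : 'I_N, (p < q)%N -> lam q <= lam p) ->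
  exists mu nu, [/\ is_partition mu, is_partition nu, (size mu + size nu <= N)%N
                  & forall p, weight mu nu p = lam p].
Proof.
move=> dom.
pose L (i : nat) : int := if insub i is Some p then lam p else 0.
have LE (p : 'I_N) : L p = lam p by rewrite /L valK.
have Lmono i j : (i <= j)%N -> (j < N)%N -> L j <= L i.
  rewrite leq_eqVlt => /orP[/eqP -> //|ij] jN.
  have iN := ltn_trans ij jN.
  by rewrite -[i]/(val (Ordinal iN)) -[j]/(val (Ordinal jN)) !LE dom.
have [|k kN Hk] := @downset_threshold (fun i => 0 < L i) N.
  by move=> i j ij jN /= Lj; apply: lt_le_trans Lj _; apply: Lmono.
have [|k' kN' Hk'] := @downset_threshold (fun i => L (N.-1 - i)%N < 0) N.
  move=> i j ij jN /= Lj; apply: le_lt_trans Lj; apply: Lmono; lia.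
have Lpos i : (i < k)%N -> 0 < L i by move=> ik; rewrite Hk //; lia.
have Lneg i : (i < k')%N -> L (N.-1 - i)%N < 0 by move=> ik; rewrite Hk' //; lia.
(* If the positive and negative ranges overlapped, the entry at position [k - 1] would have both
   signs. *)
have kk' : (k + k' <= N)%N.
  rewrite leqNgt; apply/negP => big.
  have := Lpos k.-1; have := Lneg (N - k)%N.
  have -> : (N.-1 - (N - k) = k.-1)%N by lia.
  by move=> h1 h2; have := h1 ltac:(lia); have := h2 ltac:(lia); lia.
pose mu := mkseq (fun i => `|L i|%N) k.
pose nu := mkseq (fun i => `|L (N.-1 - i)%N|%N) k'.
exists mu, nu; split; rewrite ?size_mkseq //.
- apply/andP; split.
    apply/(sortedP 0%N) => i; rewrite size_mkseq => ik.
    rewrite !nth_mkseq //; last exact: ltnW.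
    by have := Lpos _ ik; have := @Lmono i i.+1 (leqnSn _) ltac:(lia); rewrite /geq /=; lia.
  apply/allP => x /mapP[i]; rewrite mem_iota add0n => /andP[_ ik] ->.
  by have := Lpos _ ik; lia.
- apply/andP; split.
    apply/(sortedP 0%N) => i; rewrite size_mkseq => ik.
    rewrite !nth_mkseq //; last exact: ltnW.
    have := Lneg _ ik; have := Lneg _ (ltnW ik).
    by have := @Lmono (N.-1 - i.+1)%N (N.-1 - i)%N ltac:(lia) ltac:(lia); rewrite /geq /=; lia.
  apply/allP => x /mapP[i]; rewrite mem_iota add0n => /andP[_ ik] ->.
  by have := Lneg _ ik; lia.
move=> p; have pN := ltn_ord p; rewrite /weight !size_mkseq -LE.
case: ltnP => pk; first by rewrite nth_mkseq //; have := Lpos _ pk; lia.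
have pE : (N.-1 - (N.-1 - p) = p)%N by lia.
case: ltnP => pk'; first by rewrite nth_mkseq // pE; have := Lneg _ pk'; rewrite pE; lia.
have := Hk p pN; have := Hk' (N.-1 - p)%N ltac:(lia); rewrite pE.
by rewrite !ltnNge pk pk' /= => /negbT h1 /negbT h2; lia.
Qed.

Section HwvExistence.
Variables (C : numClosedFieldType) (N m n : nat).
Local Notation V := (tensor C N m n).
Local Notation idx := (midx N m * midx N n)%type.
Implicit Types (v : V) (W : V -> Prop) (ab : idx).

(** Earlier positions get larger powers of the base, and the shifted digits lie between 0 and
    [m + n], so nothing carries. [K] is the total contribution of the shift by [n]. *)
Let e (p : nat) : nat := ((m + n).+1 ^ (N.-1 - p))%N.
Let K : nat := (n * \sum_(p < N) e p)%N.

(* The base-[(m+n).+1] encoding of the weight of the basis tensor [ab],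
   shifted by [n] to have natural digits; the order on heights refines the
   dominance order on weights. *)
Definition height ab : nat :=
  (\sum_(p < N) (cnt ab.1 p + (n - cnt ab.2 p)) * e p)%N.

Lemma cnt_le k (a : midx N k) p : (cnt a p <= k)%N.
Proof.
rewrite -[X in (_ <= X)%N]card_ord -sum1_card; apply: leq_sum.
by move=> i _; case: (_ == _).
Qed.

Lemma sum_cnt k (a : midx N k) (f : 'I_N -> nat) :
  (\sum_p cnt a p * f p = \sum_i f (a i))%N.
Proof.
under eq_bigr do rewrite /cnt big_distrl.
rewrite exchange_big; apply: eq_bigr => i _ /=.
rewrite (bigD1 (a i)) //= eqxx mul1n big1 ?addn0 // => p.
by rewrite eq_sym => /negPf ->.
Qed.

Lemma heightE ab :
  (height ab + \sum_j e (ab.2 j) = \sum_i e (ab.1 i) + K)%N.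
Proof.
rewrite -(sum_cnt ab.1 (fun p => e p)) -(sum_cnt ab.2 (fun p => e p)) /K big_distrr -!big_split /=.
apply: eq_bigr => p _; rewrite -mulnDl -addnA subnK ?cnt_le //.
by rewrite mulnDl.
Qed.

Lemma height_digits ab ab' : height ab = height ab' ->
  forall p, (cnt ab.1 p)%:Z - (cnt ab.2 p)%:Z = (cnt ab'.1 p)%:Z - (cnt ab'.2 p)%:Z.
Proof.
move=> H p.
have bd (x : idx) q : (cnt x.1 q + (n - cnt x.2 q) < (m + n).+1)%N.
  by have := cnt_le x.1 q; have := cnt_le x.2 q; lia.
have /(_ p) := digits_inj (bd ab) (bd ab') H.
by have := cnt_le ab.2 p; have := cnt_le ab'.2 p; lia.
Qed.

Definition hcomp (h : nat) v : V := [ffun ab => if height ab == h then v ab else 0].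

(** The torus element with entries [t ^ e p] scales the basis tensor [ab] by [t ^ (height ab - K)].
    Multiplying by [t ^ K] gives a polynomial whose coefficients are the height components, and
    interpolation puts each of them in [W]. *)
Lemma hcomp_in W v h : is_subspace W -> D_invariant W -> W v -> W (hcomp h v).
Proof.
move=> [W0 WD] Winv Wv.
(* The bound also exceeds [h], so [h] is a valid index even if no basis tensor has that height. *)
pose D := (maxn h (\max_(ab : idx) height ab)).+1.
have hD : (h < D)%N by rewrite ltnS leq_maxl.
apply: (@vandermonde_coef C V W D (fun d => hcomp d v) W0 WD _ (Ordinal hD)) => t.
pose t' : C := t.+1%:R.
have t'0 : t' != 0 by rewrite pnatr_eq0.
pose r : 'rV[C]_N := \row_p t' ^+ e p.
have rnz : nonzero_row r by move=> p; rewrite mxE expf_neq0.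
suff -> : \sum_(d < D) t' ^+ d *: hcomp d v =
    t' ^+ K *: act (diag_mx r) (diag_mx r) v + 0.
  by apply: WD => //; apply: Winv => //; exact: (invmx_diag rnz).1.
apply/ffunP => ab; have abD : (height ab < D)%N.
  by rewrite ltnS leq_max (leq_bigmax ab) orbT.
rewrite addr0 sum_ffunE (bigD1 (Ordinal abD)) //= big1 => [|d dne]; last first.
  rewrite scale_tensorE ffunE ifN ?mulr0 //.
  by apply: contra dne => /eqP E; apply/eqP/val_inj.
rewrite addr0 !scale_tensorE ffunE eqxx; case: ab abD => a b abD.
rewrite act_diag // mulrA; congr (_ * _).
under eq_bigr do rewrite mxE.
under [X in _ * (_ * X)]eq_bigr do rewrite mxE.
rewrite prodfV !prodrXr mulrA -exprD [(K + _)%N]addnC -(heightE (a, b)).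
by rewrite exprD mulfK // expf_neq0.
Qed.

Lemma e_mono (p q : 'I_N) : (p <= q)%N -> (e q <= e p)%N.
Proof. by move=> pq; rewrite leq_pexp2l //; lia. Qed.

Lemma e_lt (p q : 'I_N) : (0 < m + n)%N -> (p < q)%N -> (e q < e p)%N.
Proof. by move=> mn pq; rewrite ltn_exp2l //; have := ltn_ord q; lia. Qed.

Lemma unitri_inv (u : 'M[C]_N) : unitri u -> u \in unitmx /\ unitri (invmx u).
Proof.
move=> [u0 u1].
have uu : u \in unitmx.
  rewrite unitmxE -det_tr det_trig ?unitfE.
    by apply/prodf_neq0 => i _; rewrite mxE u1 oner_neq0.
  by apply/is_trig_mxP => i j ij; rewrite mxE u0.
split=> //; pose Y := invmx u.
(* Column [j] of [Y u = 1] expresses column [j] of [Y] through the earlier ones, which permits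
   induction on [j]. *)
have rec i j : Y i j = (i == j)%:R - \sum_(k < N | (k < j)%N) Y i k * u k j.
  have := congr1 (fun A : 'M_N => A i j) (mulVmx uu); rewrite !mxE => <-.
  rewrite (bigID (fun k : 'I_N => (k < j)%N)) /= addrAC subrr add0r.
  rewrite (bigD1 j) ?ltnn //= u1 mulr1 big1 ?addr0 // => k /andP[kj kne].
  by rewrite u0 ?mulr0 // ltn_neqAle eq_sym; rewrite -leqNgt in kj; rewrite kj andbT.
have low (i j : 'I_N) : (j < i)%N -> Y i j = 0.
  have [d] := ubnP (j : nat); elim: d j => // d IH j jd ji.
  rewrite rec big1 ?subr0 => [|k kj]; first by case: eqP ji => // ->; rewrite ltnn.
  by rewrite IH ?mul0r //; lia.
split=> // i; rewrite -/Y rec eqxx big1 ?subr0 // => k ki.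
by rewrite low ?mul0r.
Qed.

(** The entries of [u v - v] can be nonzero only at heights above [h], where every vector of [W]
    vanishes. *)
Lemma D_hwv_top W v h (lam : 'I_N -> int) : (0 < m + n)%N ->
  is_subspace W -> D_invariant W -> W v -> v != 0 ->
  (forall ab, v ab != 0 -> height ab = h) ->
  (forall w ab, W w -> w ab != 0 -> (height ab <= h)%N) ->
  (forall ab p, v ab != 0 -> lam p = (cnt ab.1 p)%:Z - (cnt ab.2 p)%:Z) ->
  D_hwv W lam v.
Proof.
move=> mn Wsub Winv Wv v0 vh top vlam; split=> //.
  move=> t tnz; apply/ffunP => -[a b]; rewrite act_diag // scale_tensorE.
  have [->|vab] := eqVneq (v (a, b)) 0; first by rewrite !mulr0.
  congr (_ * _); rewrite /torus_char.
  under [RHS]eq_bigr => p _ do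
    rewrite (vlam _ p vab) /= expfzDr // -invr_expz -[_ ^ Posz (cnt a p)]/(_ ^+ cnt a p)
     -[_ ^ Posz (cnt b p)]/(_ ^+ cnt b p).
  rewrite big_split /= !prodfV.
  have pc k (c : midx N k) : \prod_p t 0 p ^+ cnt c p = \prod_i t 0 (c i).
    under eq_bigr do rewrite /cnt -prodrXr.
    rewrite exchange_big; apply: eq_bigr => i _ /=.
    rewrite (bigD1 (c i)) //= eqxx expr1 big1 ?mulr1 // => p.
    by rewrite eq_sym => /negPf ->.
  by rewrite !pc.
move=> u uu; have [uunit [iu0 iu1]] := unitri_inv uu; have [u0 u1] := uu.
have Wu : W (act u u v) by apply: Winv.
apply/ffunP => ab.
(* upper unitriangular matrices only raise heights, strictly off the diagonal *)
have raise ab' : act_coef u (invmx u) ab ab' != 0 -> ab' != ab -> (height ab' < height ab)%N.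
  rewrite /act_coef mulf_eq0 negb_or => /andP[/prodf_neq0 k1 /prodf_neq0 k2] ne.
  have le1 i : (ab.1 i <= ab'.1 i)%N.
    by rewrite leqNgt; apply: contra (k1 i isT) => /u0 ->.
  have le2 j : (ab'.2 j <= ab.2 j)%N.
    by rewrite leqNgt; apply: contra (k2 j isT) => /iu0 ->.
  have s1 : (\sum_i e (ab'.1 i) <= \sum_i e (ab.1 i))%N.
    by apply: leq_sum => i _; exact: e_mono.
  have s2 : (\sum_j e (ab.2 j) <= \sum_j e (ab'.2 j))%N.
    by apply: leq_sum => i _; exact: e_mono.
  have h1 := heightE ab; have h2 := heightE ab'.
  suff : (\sum_i e (ab'.1 i) < \sum_i e (ab.1 i))%N \/
         (\sum_j e (ab.2 j) < \sum_j e (ab'.2 j))%N.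
    move: h1 h2 s1 s2; move: (height ab) (height ab') K.
    move: (\sum_i e (ab'.1 i))%N (\sum_i e (ab.1 i))%N.
    by move: (\sum_j e (ab'.2 j))%N (\sum_j e (ab.2 j))%N => *; lia.
  have lt_sum k (f g : 'I_k -> nat) i : (forall j, f j <= g j)%N -> (f i < g i)%N ->
      (\sum_j f j < \sum_j g j)%N.
    move=> fg fgi; rewrite (bigD1 i) //= [X in (_ < X)%N](bigD1 i) //=.
    by rewrite -addSn leq_add // leq_sum.
  case: (pickP (fun i => ab.1 i != ab'.1 i)) => [i ine|eq1].
    left; apply: (lt_sum _ _ _ i) => [j|]; first exact: e_mono.
    by apply: e_lt; rewrite // ltn_neqAle ine le1.
  case: (pickP (fun i => ab.2 i != ab'.2 i)) => [i ine|eq2].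
    right; apply: (lt_sum _ _ _ i) => [j|]; first exact: e_mono.
    by apply: e_lt; rewrite // ltn_neqAle eq_sym ine le2.
  case/eqP: ne; case: ab ab' {k1 k2 le1 le2 s1 s2 h1 h2} eq1 eq2 => [a b] [a' b'] /= eq1 eq2.
  by congr pair; apply/ffunP => i; apply/esym/eqP/negbFE.
have kd : act_coef u (invmx u) ab ab = 1.
  by rewrite /act_coef !big1 ?mulr1 // => i _; rewrite ?u1 ?iu1.
have [hab|hab] := leqP (height ab) h; last first.
  have -> : act u u v ab = 0.
    by apply/eqP; apply: contraTT hab => nz; rewrite -leqNgt; exact: top Wu nz.
  by apply/esym/eqP; apply: contraTT hab => /vh ->; rewrite ltnn.
rewrite actE ffunE (bigD1 ab) //= kd mul1r big1 ?addr0 // => ab' ne.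
have [->|k0] := eqVneq (act_coef u (invmx u) ab ab') 0; first by rewrite mul0r.
have lt := raise _ k0 ne.
have [->|/vh hE] := eqVneq (v ab') 0; first by rewrite mulr0.
by move: lt; rewrite hE ltnNge hab.
Qed.

Lemma act_perm (s : 'S_N) v a b :
  act (perm_mx s) (perm_mx s) v (a, b) =
  v ([ffun i => s (a i)], [ffun j => s (b j)]).
Proof.
have iE : invmx (perm_mx s) = perm_mx s^-1 :> 'M[C]_N.
  have E : perm_mx s *m perm_mx s^-1 = 1%:M :> 'M[C]_N by rewrite -perm_mxM mulgV perm_mx1.
  by rewrite -[LHS]mulmx1 -E mulmxA mulVmx ?mul1mx // unitmx_perm.
have kE ab' : act_coef (perm_mx s) (perm_mx s^-1) (a, b) ab' =
    (([ffun i => s (a i)], [ffun j => s (b j)]) == ab')%:R.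
  case: ab' => a' b'; rewrite xpair_eqE -mulnb natrM /act_coef -!prod_delta /=.
  congr (_ * _); apply: eq_bigr => i _; rewrite !mxE ffunE //.
  by rewrite (can2_eq (permKV s) (permK s)) eq_sym.
rewrite actE iE ffunE (bigD1 ([ffun i => s (a i)], [ffun j => s (b j)])) //=.
rewrite kE eqxx mul1r big1 ?addr0 // => ab' ne.
by rewrite kE eq_sym (negPf ne) mul0r.
Qed.

(** A transposition from the Weyl group swaps the digits at [p] and [q] and preserves [W]. The
    maximal height cannot grow and [e q < e p], so the digit at [p] is at least the digit at [q]. *)
Lemma top_dominant W v h ab (p q : 'I_N) : (0 < m + n)%N -> D_invariant W -> W v ->
  v ab != 0 -> height ab = h ->
  (forall w ab, W w -> w ab != 0 -> (height ab <= h)%N) ->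
  (p < q)%N ->
  (cnt ab.1 q)%:Z - (cnt ab.2 q)%:Z <= (cnt ab.1 p)%:Z - (cnt ab.2 p)%:Z.
Proof.
case: ab => a b mn Winv Wv vab hab top pq /=.
pose s := tperm p q.
pose sw k (c : midx N k) : midx N k := [ffun i => s (c i)].
have sK k (c : midx N k) : sw k (sw k c) = c.
  by apply/ffunP => i; rewrite !ffunE tpermK.
have csw k (c : midx N k) x : cnt (sw k c) x = cnt c (s x).
  by apply: eq_bigr => i _; rewrite ffunE (can2_eq (tpermK p q) (tpermK p q)).
have /top : W (act (perm_mx s) (perm_mx s) v) by apply: Winv => //; exact: unitmx_perm.
move=> /(_ (sw m a, sw n b)); rewrite act_perm -/(sw m (sw m a)) -/(sw n (sw n b)) !sK.
move=> /(_ vab); rewrite -hab /height /=.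
have qp : q != p by rewrite neq_ltn pq orbT.
rewrite (bigD1 p) //= (bigD1 q) //= [X in (_ <= X)%N](bigD1 p) //=.
rewrite [X in (_ <= _ + X)%N](bigD1 q) //= !csw tpermL tpermR !addnA.
under eq_bigr => i /andP[ip iq] do rewrite !csw tpermD 1?eq_sym //.
rewrite leq_add2r; have := e_lt mn pq.
by have := cnt_le b p; have := cnt_le b q; nia.
Qed.

Lemma D_hwv_exists W : (0 < m + n)%N -> is_subspace W -> D_invariant W ->
  (exists2 v, W v & v != 0) ->
  exists r mu nu, [/\ (r <= minn m n)%N,
    [/\ is_partition mu, is_partition nu, (sumn mu + r = m)%N, (sumn nu + r = n)%N &
        (size mu + size nu <= N)%N] & exists v, D_hwv W (weight mu nu) v].
Proof.
move=> mn Wsub Winv [v0 Wv0 v0nz].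
have supp v : v != 0 -> exists ab, v ab != 0.
  move=> vnz; case: (pickP (fun ab => v ab != 0)) => [ab|H]; first by exists ab.
  by case/eqP: vnz; apply/ffunP => ab; rewrite [RHS]ffunE; apply/eqP/negbFE.
have [ab0 v0ab] := supp _ v0nz.
have [||h [w [ab [Ww wab wh]]] top] := @bounded_max
  (fun h => exists w ab, [/\ W w, w ab != 0 & height ab = h]) (height ab0)
  (\max_(ab : idx) height ab).
- by exists v0, ab0.
- by move=> k [w [ab [_ _ <-]]]; exact: leq_bigmax.
pose v := hcomp h w.
have Wv : W v by exact: hcomp_in.
have vab : v ab != 0 by rewrite ffunE wh eqxx.
have vh ab' : v ab' != 0 -> height ab' = h.
  by rewrite ffunE; case: (eqVneq (height ab') h) => // _; rewrite eqxx.
have top' w' ab' : W w' -> w' ab' != 0 -> (height ab' <= h)%N.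
  by move=> Ww' nz; apply: top; exists w', ab'.
(* Any index in the support of [v] defines the same weight, since equal heights have equal
   digits. *)
pose lam p := (cnt ab.1 p)%:Z - (cnt ab.2 p)%:Z.
have dom (p q : 'I_N) : (p < q)%N -> lam q <= lam p.
  exact: top_dominant Wv vab wh top'.
have [mu [nu [pmu pnu smn wE]]] := dominant_weight dom.
have scnt k (c : midx N k) : \sum_p (cnt c p)%:Z = k%:Z.
  have := sum_cnt c (fun=> 1%N); under eq_bigr do rewrite muln1.
  rewrite sum1_card card_ord => {2}<-.
  by rewrite -[RHS]natz natr_sum; apply: eq_bigr => p _; rewrite natz.
have Slam : (sumn mu)%:Z - (sumn nu)%:Z = m%:Z - n%:Z.
  rewrite -(scnt _ ab.1) -(scnt _ ab.2) -sumrB.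
  transitivity (\sum_(p < N) weight mu nu p); last by apply: eq_bigr => p _; rewrite wE.
  by rewrite (sum_weight (f := fun _ x => x)) // sumrN !sumn_nth.
(* [|mu|] is the sum of the positive parts of the weight, each at most the number of occurrences of
   [p] among the [V]-indices; these numbers add up to [m]. *)
have Smu : (sumn mu <= m)%N.
  rewrite -lez_nat -(scnt _ ab.1).
  have -> : (sumn mu)%:Z = \sum_(p < N) Num.max 0 (weight mu nu p).
    rewrite (sum_weight (f := fun _ x => Num.max 0 x)) ?maxxx //.
    rewrite [X in _ = _ + X]big1 => [|j _]; last by lia.
    by rewrite addr0 sumn_nth; apply: eq_bigr => i _; lia.
  by apply: ler_sum => p _; rewrite wE /lam; lia.
(* By [Slam], this [r] also equals [n - |nu|]. *)
exists (m - sumn mu)%N, mu, nu; split; [lia|split=> //; lia|].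
exists v; apply: (@D_hwv_top W v h) => //.
  by apply: contraNneq vab => ->; rewrite ffunE.
by move=> ab' p /vh E; rewrite wE /lam; apply: height_digits; rewrite E.
Qed.

(** A vector space of maximal dimension inside the predicate exhausts it, and provides the dimension
    on which to induct. *)
Lemma subspace_vspace W : is_subspace W ->
  exists U : {vspace V}, forall v, v \in U <-> W v.
Proof.
move=> [W0 WD].
have [||d [U [UW Ud]] maxd] := @bounded_max
  (fun d => exists U : {vspace V}, (forall v, v \in U -> W v) /\ \dim U = d) 0
  (\dim {:V}).
- by exists 0%VS; split; [move=> v; rewrite memv0 => /eqP ->|rewrite dimv0].
- by move=> k [U [_ <-]]; rewrite dimvS ?subvf.
exists U => v; split; first exact: UW.
move=> Wv.
have U'W : exists U' : {vspace V}, (forall v, v \in U' -> W v) /\ \dim U' = \dim (U + <[v]>)%VS.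
  exists (U + <[v]>)%VS; split=> // x /memv_addP[y /UW Wy [z /vlineP[c ->] ->]].
  by rewrite addrC; exact: WD.
have := maxd _ U'W; rewrite -Ud => dle.
have : U == (U + <[v]>)%VS by rewrite eqEdim addvSl.
by move/eqP ->; rewrite (subvP (addvSr _ _)) // memv_line.
Qed.

Lemma D_irreducible_exists W : is_subspace W -> D_invariant W ->
  (exists2 v, W v & v != 0) ->
  exists2 W', forall v, W' v -> W v & D_irreducible W'.
Proof.
move=> Wsub; have [U UW] := subspace_vspace Wsub.
have [d] := ubnP (\dim U); elim: d W U Wsub UW => // d IH W U Wsub UW Ud Winv Wnz.
have [irr|nirr] := classic (D_irreducible W); first by exists W.
have [W1 H1] : exists W1, [/\ is_subspace W1, D_invariant W1, (forall v, W1 v -> W v),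
    exists2 v, W1 v & v != 0 & exists2 v, W v & ~ W1 v].
  apply: NNPP => no; apply: nirr; split=> // W1 sub1 inv1 W1W.
  have [z|nz] := classic (forall v, W1 v -> v = 0); first by left.
  right=> v Wv; apply: NNPP => W1v; apply: no; exists W1; split=> //; last by exists v.
  apply: NNPP => no; apply: nz => x W1x; apply: NNPP => /eqP xnz.
  by apply: no; exists x.
case: H1 => sub1 inv1 W1W nz1 [x Wx W1x].
have [U1 UW1] := subspace_vspace sub1.
have [|W2 W21 irr2] := IH W1 U1 sub1 UW1 _ inv1 nz1.
  apply: leq_trans (_ : \dim U <= d)%N; last by rewrite -ltnS.
  rewrite ltn_neqAle dimvS ?andbT; last by apply/subvP => v /UW1/W1W/UW.
  apply/eqP => dE; apply: W1x; apply/UW1.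
  have /eqP -> : U1 == U by rewrite eqEdim dE leqnn andbT; apply/subvP => v /UW1/W1W/UW.
  exact/UW.
by exists W2 => // v /W21/W1W.
Qed.

End HwvExistence.

(** * The product formula on an irreducible component *)

(** A crude bound, whose purpose is to make [I(rho, sigma)] finite. *)
Lemma content_bound (a : seq nat) :
  `|content a| <= (sumn a)%:Z * ((sumn a)%:Z + (size a)%:Z).
Proof.
have nth_le i : (i < size a)%N -> (nth 0%N a i <= sumn a)%N.
  elim: a i => // x a IH [|i] /=; first by rewrite leq_addr.
  by rewrite ltnS => /IH h; apply: leq_trans h _; rewrite leq_addl.
apply: le_trans (ler_norm_sum _ _ _) _.
rewrite [X in _ <= X * _]sumn_nth mulr_suml; apply: ler_sum => i _.
apply: le_trans (ler_norm_sum _ _ _) _.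
rewrite (_ : _ * _ = \sum_(j < nth 0%N a i) ((sumn a)%:Z + (size a)%:Z)); last first.
  by rewrite sumr_const card_ord -mulr_natl natz.
apply: ler_sum => j _.
by have := nth_le i (ltn_ord i); have := ltn_ord j; have := ltn_ord i; lia.
Qed.

(** No decision procedure for [P] is given, so an interval is filtered element by element with
    classical case analysis. *)
Lemma bounded_int_seq (P : int -> Prop) (B : nat) :
  (forall x, P x -> `|x| <= B%:Z) -> exists2 s : seq int, uniq s & forall x, x \in s <-> P x.
Proof.
move=> PB.
have [s sP] : exists s : seq int, forall x, x \in s <-> (-B%:Z <= x <= B%:Z) /\ P x.
  have : exists s : seq int, forall x, x \in s <->
      x \in [seq i%:Z - B%:Z | i <- iota 0 (B + B).+1] /\ P x.
    elim: [seq _ | _ <- _] => [|y l [s IH]]; first by exists [::] => x; split=> // -[].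
    have [Py|nPy] := classic (P y); [exists (y :: s)|exists s] => x; rewrite ?in_cons.
      split=> [/orP[/eqP ->|/IH[xl Px]]|[/orP[/eqP ->|xl] Px]]; rewrite ?eqxx //.
        by rewrite xl orbT.
      by apply/orP; right; apply/IH.
    split=> [/IH[xl Px]|[/orP[/eqP E|xl] Px]]; first by rewrite xl orbT.
      by rewrite E in Px.
    exact/IH.
  case=> s H; exists s => x; split=> [/H[/mapP[i]]|[xB Px]].
    by rewrite mem_iota => iB -> ?; split=> //; lia.
  apply/H; split=> //; apply/mapP; exists (absz (x + B%:Z)); last by lia.
  by rewrite mem_iota; lia.
exists (undup s); first exact: undup_uniq.
move=> x; rewrite mem_undup; split=> [/sP[] //|Px]; apply/sP; split=> //.
by have := PB x Px; lia.
Qed.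

Section TracelessProjector.
Variables (C : numClosedFieldType) (N m n : nat).
Local Notation V := (tensor C N m n).
Local Notation A := (@Aop C N m n).
Implicit Types (v w : V) (W : V -> Prop).

Lemma subspace_Aop W w : is_subspace W -> GG_invariant W -> W w -> W (A w).
Proof.
move=> Wsub Winv Ww; have [W0 WD] := Wsub.
have WL p q v : W v -> W (lieL (delta_mx p q) v).
  move=> Wv; rewrite -[lieL _ _]addr0 -(lieR0 v); apply: subspace_lie => // t.
  rewrite scaler0 addr0 -[X in gact _ X]invmx1 -actE.
  by apply: Winv; rewrite ?unitmx1 ?elementary_unit.
have WR p q v : W v -> W (lieR (delta_mx p q) v).
  move=> Wv; rewrite -[lieR _ _]add0r -(lieL0 v); apply: subspace_lie => // t.
  rewrite scaler0 addr0 -[X in gact _ X]invmxK -actE.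
  by apply: Winv; rewrite ?unitmx1 ?unitmx_inv ?elementary_unit.
rewrite AopE; elim/big_rec: _ => // p x _ Wx; rewrite -[X in X + _]scale1r; apply: (WD) => //.
elim/big_rec: _ => // q y _ Wy; rewrite -[X in X + _]scale1r; apply: WD => //.
exact/WL/WR.
Qed.

(** * Polynomials in the contraction operator *)

Definition shiftA (a : C) w : V := A w - a *: w.
Definition prodA (L : seq C) w : V := foldr shiftA w L.

Lemma AopB v w : A (v - w) = A v - A w.
Proof. exact: raddfB. Qed.
Lemma AopZ c w : A (c *: w) = c *: A w.
Proof. exact: linearZ. Qed.

Lemma shiftAC a b w : shiftA a (shiftA b w) = shiftA b (shiftA a w).
Proof.
have abel (x p q r : V) : x - p - (q - r) = x - q - (p - r).
  by rewrite !opprB addrACA [RHS]addrACA [- p - q]addrC.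
by rewrite /shiftA !AopB !AopZ !scalerBr !scalerA [b * a]mulrC abel.
Qed.

Lemma shiftA0 a : shiftA a 0 = 0.
Proof. by rewrite /shiftA raddf0 scaler0 subr0. Qed.

Lemma prodA_shift L a w : prodA L (shiftA a w) = shiftA a (prodA L w).
Proof. by elim: L => //= b L ->; rewrite shiftAC. Qed.

Lemma prodA_rem L a w : a \in L -> prodA L w = shiftA a (prodA (rem a L) w).
Proof.
elim: L => //= b L IH; rewrite in_cons eq_sym; case: eqVneq => [-> //|_] /= aL.
by rewrite IH //= shiftAC.
Qed.

Lemma subspace_prodA W L w : is_subspace W -> GG_invariant W -> W w -> W (prodA L w).
Proof.
move=> Wsub Winv Ww; elim: L => //= a L IH.
rewrite /shiftA addrC -scaleNr; apply: Wsub.2 => //; exact: subspace_Aop.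
Qed.

Definition polyA k (p : {poly C}) w : V := \sum_(i < k) p`_i *: iter i A w.

Lemma polyA_widen k k' (p : {poly C}) w : (size p <= k)%N -> (k <= k')%N -> polyA k' p w = polyA k p w.
Proof.
move=> pk kk'; rewrite /polyA [RHS](big_ord_widen k' (fun i => p`_i *: iter i A w)) //.
rewrite [RHS]big_mkcond; apply: eq_bigr => i _; case: ltnP => // ki.
by rewrite nth_default ?scale0r // (leq_trans pk).
Qed.

Lemma polyA_XsubC k a (p : {poly C}) w : (size p <= k)%N ->
  polyA k.+1 (('X - a%:P) * p) w = shiftA a (polyA k p w).
Proof.
move=> pk; rewrite /polyA.
under eq_bigr do rewrite mulrBl coefB coefXM coefCM scalerBl.
rewrite sumrB big_ord_recl /= scale0r add0r /shiftA; congr (_ - _).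
  by rewrite raddf_sum; apply: eq_bigr => i _ /=; rewrite AopZ.
rewrite big_ord_recr /= nth_default // mulr0 scale0r addr0 scaler_sumr.
by apply: eq_bigr => i _; rewrite scalerA.
Qed.

Lemma polyA_prod L w :
  polyA (size L).+1 (\prod_(z <- L) ('X - z%:P)) w = prodA L w.
Proof.
elim: L => [|z L IH].
  by rewrite big_nil /polyA big_ord1 coef1 scale1r.
by rewrite big_cons polyA_XsubC ?IH //= size_prod_XsubC.
Qed.

(** The first [dim V + 1] iterates of [w] are linearly dependent; the polynomial of such a relation
    splits over the closed field, and its leading coefficient can be cancelled. *)
Lemma prodA_annihilates w : exists L, prodA L w = 0.
Proof.
pose d := \dim {:V}.
pose X := [tuple iter i A w | i < d.+1].
have nfree : ~~ free X.
  by rewrite /free size_tuple neq_ltn ltnS dimvS ?subvf.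
have [k [kX [i0 ki0]]] : exists k : 'I_d.+1 -> C,
    \sum_i k i *: X`_i = 0 /\ exists i, k i != 0.
  apply: NNPP => no; case/negP: nfree; apply/freeP => k kX i.
  by apply: NNPP => /eqP ki; apply: no; exists k; split=> //; exists i.
pose p := \poly_(i < d.+1) k (inord i).
have p0 : p != 0.
  apply: contraNneq ki0 => p0.
  by have := coef_poly d.+1 (fun i => k (inord i)) i0; rewrite -/p p0 coef0 ltn_ord inord_val => <-.
have pA : polyA d.+1 p w = 0.
  rewrite -kX; apply: eq_bigr => i _; rewrite coef_poly ltn_ord inord_val.
  by rewrite (nth_map i) ?size_enum_ord // nth_ord_enum.
have [L pE] := closed_field_poly_normal p.
exists L; have lp : lead_coef p != 0 by rewrite lead_coef_eq0.
have sL : ((size L).+1 <= d.+1)%N.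
  rewrite -(size_prod_XsubC L id) -(size_scale _ lp) -pE; exact: size_poly.
rewrite -polyA_prod -(@polyA_widen _ d.+1) ?size_prod_XsubC //.
apply: (scalerI lp); rewrite scaler0 -[RHS]pA {2}pE /polyA scaler_sumr.
by apply: eq_bigr => i _; rewrite coefZ scalerA.
Qed.

Lemma PopE (S : seq C) w : exists2 c, c != 0 &
  Pop S w = c *: prodA [seq a <- S | a != 0] w.
Proof.
elim: S => [|a S [c c0 IH]] /=; first by exists 1; rewrite ?oner_neq0 ?scale1r.
case: eqVneq => [_|a0] /=; first by exists c.
exists (- a^-1 * c); first by rewrite mulf_neq0 // oppr_eq0 invr_eq0.
have e : - a^-1 * c * a = - c by rewrite mulrAC mulNr mulVf // mulN1r.
by rewrite IH /shiftA AopZ scalerBr !scalerA e mulNr !scaleNr opprK addrC.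
Qed.

(** If 0 is in [S], its single factor in [prodA S] is the extra [A] applied here; otherwise the
    nonzero factors are all of [prodA S] and already kill [w]. *)
Lemma Pop_ker (S : seq C) w : uniq S -> prodA S w = 0 -> A (Pop S w) = 0.
Proof.
move=> uS Sw; have [c _ ->] := PopE S w; rewrite AopZ.
suff -> : A (prodA [seq a <- S | a != 0] w) = 0 by rewrite scaler0.
have [S0|S0] := boolP (0 \in S).
  by move: Sw; rewrite (prodA_rem _ S0) rem_filter // /shiftA scale0r subr0.
have -> : [seq a <- S | a != 0] = S.
  by apply/all_filterP/allP => a aS; apply: contraNneq S0 => <-.
by rewrite Sw raddf0.
Qed.

Lemma in_trace_span_Aop w : in_trace_span (A w).
Proof. by exists (fun i j => tr i j w). Qed.

(** Every factor is [1] plus a multiple of [A], so the product is [1] modulo the image of [A], which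
    lies in the trace span. *)
Lemma Pop_sub_Aop (S : seq C) w : exists y, w - Pop S w = A y.
Proof.
elim: S => [|a S [y IH]] /=; first by exists 0; rewrite subrr raddf0.
case: eqP => _; first by exists y.
by exists (y + a^-1 *: Pop S w); rewrite opprB addrCA IH raddfD /= AopZ addrC.
Qed.

Lemma Pop_eigen (S : seq C) (x : C) v : A v = x *: v -> x \notin S ->
  exists2 c, c != 0 & Pop S v = c *: v.
Proof.
move=> Av; elim: S => [|a S IH] /=; first by exists 1; rewrite ?oner_neq0 ?scale1r.
rewrite in_cons negb_or => /andP[xa /IH[c c0 E]].
case: eqVneq => [_|a0]; first by exists c.
exists (c * (1 - a^-1 * x)).
  rewrite mulf_neq0 // subr_eq0; apply: contra xa => /eqP E1.
  by rewrite -[a]mulr1 E1 mulrA mulfV // mul1r.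
rewrite E AopZ Av !scalerA -scalerBl; congr (_ *: _); ring.
Qed.

Lemma traceless_Aop w : traceless w -> A w = 0.
Proof.
move=> tl; rewrite /Aop big1 // => i _; rewrite big1 // => j _.
by rewrite /tau tl; apply/ffunP => ab; rewrite !ffunE; case: ifP.
Qed.

(** * The spectrum on a copy of one irreducible *)

Section Component.
Variables rho sigma : seq nat.
Hypotheses (srho : sumn rho = m) (lrho : (size rho <= N)%N).
Hypotheses (ssig : sumn sigma = n) (lsig : (size sigma <= N)%N).

Lemma inI_eigenvector x : inI C N m n rho sigma x ->
  exists W v, [/\ isoU W rho sigma, W v, v != 0 & A v = x%:~R *: v].
Proof.
case=> r [_ [mu [nu [[_ _ smu snu smn] [[W [isoW [W' [sW _ [v hv]]]]] ->]]]]].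
have [W'v v0 _ _] := hv; exists W, v; split=> //; first exact: sW.
exact: (Aop_hwv srho lrho ssig lsig smu snu smn isoW sW hv).
Qed.

Lemma inI_bound x : inI C N m n rho sigma x ->
  `|x| <= (N * m + 2 * (m * (m + N)) + 2 * (n * (n + N)))%N%:Z.
Proof.
case=> r [rle [mu [nu [[_ _ smu snu smn] [_ ->]]]]].
have bd (a : seq nat) k : (sumn a <= k)%N -> (size a <= N)%N ->
    `|content a| <= (k * (k + N))%N%:Z.
  move=> ak aN; apply: le_trans (content_bound a) _.
  by rewrite -PoszD -PoszM lez_nat leq_mul // leq_add.
have := bd rho m; have := bd sigma n; have := bd mu m; have := bd nu n.
rewrite srho ssig.
have rm : (N * r <= N * m)%N by rewrite leq_mul2l; lia.
move=> h1 h2 h3 h4.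
have := h1 ltac:(lia) ltac:(lia); have := h2 ltac:(lia) ltac:(lia).
have := h3 ltac:(lia) ltac:(lia); have := h4 ltac:(lia) ltac:(lia).
by move: rm; move: (N * r)%N (N * m)%N (m * (m + N))%N (n * (n + N))%N => *; lia.
Qed.

Hypothesis m_gt0 : (0 < m)%N.

Lemma eigenvalue_inI W w (a : C) : isoU W rho sigma -> W w -> w != 0 ->
  A w = a *: w -> exists2 x, inI C N m n rho sigma x & a = x%:~R.
Proof.
move=> isoW Ww w0 Aw; have [[[W0 WD] Winv _ _] _] := isoW.
pose Wa v := W v /\ A v = a *: v.
have Wasub : is_subspace Wa.
  split=> [|c u v [Wu Au] [Wv Av]]; first by split; rewrite ?raddf0 ?scaler0.
  split; first exact: WD.
  by rewrite linearP /= Au Av scalerDr !scalerA mulrC.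
have Wainv : D_invariant Wa.
  move=> g gu v [Wv Av]; split; first exact: Winv.
  by rewrite actE -Aop_gact // Av linearZ.
have [|W' sW' irrW'] := D_irreducible_exists Wasub Wainv; first by exists w.
have [W'sub W'inv W'nz _] := irrW'.
have [|r [mu [nu [rle parts [v hv]]]]] := D_hwv_exists _ W'sub W'inv W'nz.
  by rewrite addn_gt0 m_gt0.
have [_ _ smu snu smn] := parts; have [W'v v0 _ _] := hv.
exists ((N * r)%N%:Z + (content rho - content mu) + (content sigma - content nu)).
  exists r; split=> //; exists mu, nu; split=> //; split=> //.
  exists W; split=> //; exists W'; split=> //; last by exists v.
  by move=> u /sW'[].
have [_ Av] := sW' _ W'v.
have := Aop_hwv srho lrho ssig lsig smu snu smn isoW (fun u W'u => (sW' u W'u).1) hv.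
rewrite Av => /eqP; rewrite -subr_eq0 -scalerBl scaler_eq0 (negPf v0) orbF subr_eq0.
by move/eqP.
Qed.

(** Start from any annihilating list and delete its factors one by one. If [a] comes from
    [I(rho, sigma)], then [A - a] occurs twice and semisimplicity, valid since integers are real,
    removes one copy. Otherwise a nonzero result would be an eigenvector in [W] with eigenvalue
    outside [I(rho, sigma)]. *)
Lemma prodA_component (s : seq int) W w :
  (forall x, x \in s <-> inI C N m n rho sigma x) -> isoU W rho sigma -> W w ->
  prodA [seq (x%:~R : C) | x <- s] w = 0.
Proof.
move=> sI isoW Ww; have [[Wsub Winv _ _] _] := isoW.
have [L] := prodA_annihilates w; elim: L w Ww => [|a L IH] w Ww /=.
  by move=> ->; elim: s {sI} => //= x s ->; rewrite shiftA0.
rewrite -prodA_shift => /IH; set s' := [seq _ | _ <- _].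
have Wa : W (shiftA a w) by exact: (@subspace_prodA W [:: a]).
move/(_ Wa); rewrite prodA_shift => E.
have [|as'] := boolP (a \in s').
  case/mapP=> x xs aE; have as' : a \in s' by rewrite aE map_f.
  move: E; rewrite (prodA_rem _ as'); apply: Aop_semisimple.
  by rewrite aE rmorph_int.
apply/eqP; apply: contraNT as' => nz.
have [||x xI ->] := eigenvalue_inI (a := a) isoW _ nz.
- exact: subspace_prodA.
- by apply/eqP; rewrite -subr_eq0; apply/eqP.
by rewrite map_f //; apply/sI.
Qed.

End Component.
End TracelessProjector.

Theorem theorem2p9 (C : numClosedFieldType) (N m n : nat) (rho sigma : seq nat) :
  (1 <= m)%N -> (1 <= n)%N -> (1 <= N)%N ->
  is_partition rho -> sumn rho = m -> (size rho <= N)%N ->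
  is_partition sigma -> sumn sigma = n -> (size sigma <= N)%N ->
  exists s : seq int,
    [/\ uniq s,
        (forall x, x \in s <-> inI C N m n rho sigma x),
        (forall x, x \in s -> is_eigenvalue N m n (x%:~R : C)),
        agrees_with_traceless N m n [seq (x%:~R : C) | x <- s] rho sigma &
        (forall S : seq C, uniq S ->
           (forall a, a \in S -> is_eigenvalue N m n a) ->
           agrees_with_traceless N m n S rho sigma ->
           forall x, x \in s -> x != 0 -> (x%:~R : C) \in S)].
Proof.
move=> m0 n0 N0 _ srho lrho _ ssig lsig.
have [s us sI] := bounded_int_seq (@inI_bound C N m n rho sigma srho lrho ssig lsig).
have eigen x : x \in s -> exists (W : tensor C N m n -> Prop) (v : tensor C N m n),
    [/\ isoU W rho sigma, W v, v != 0 & Aop v = (x%:~R : C) *: v].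
  by move=> /sI xI; exact: (inI_eigenvector srho lrho ssig lsig xI).
exists s; split=> //.
- by move=> x /eigen[W [v [_ _ v0 Av]]]; exists v.
- move=> W isoW w Ww; split; last first.
    by have [y ->] := Pop_sub_Aop [seq (x%:~R : C) | x <- s] w; exact: in_trace_span_Aop.
  apply: Aop_eq0_traceless => //; apply: Pop_ker; last first.
    exact: (prodA_component srho lrho ssig lsig m0 sI isoW Ww).
  by rewrite map_inj_uniq //; exact: intr_inj.
(* If [x] were missing from [S], [Pop S] would send [v] to a nonzero multiple of itself, traceless
   and hence killed by [A], whereas [A v = x v]. The value 0 gives no factor of the product, so only
   nonzero [x] can be forced. *)
move=> S _ _ agree x /eigen[W [v [isoW Wv v0 Av]]] x0.
apply: contraT => xS; have [c c0 E] := Pop_eigen Av xS.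
have [/traceless_Aop + _] := agree W isoW v Wv.
rewrite E AopZ Av scalerA => /eqP.
by rewrite scaler_eq0 (negPf v0) orbF mulf_eq0 (negPf c0) intr_eq0 (negPf x0).
Qed.
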